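(* Let $(X,\|\cdot\|,\tau)$ be a semi-Montel Saks space over $\mathbb{K}\in\{\mathbb{R},\mathbb{C}\}$ with mixed topology $\gamma=\gamma(\|\cdot\|,\tau)$. Let $X_\gamma'$ be the topological dual of $(X,\gamma)$ and let $\|\cdot\|_{X_\gamma'}$ be the restriction to $X_\gamma'$ of the dual norm of $(X,\|\cdot\|)'$. Then the following assertions are equivalent. (a) $(X,\gamma)$ has the approximation property. (b) $(X_\gamma',\|\cdot\|_{X_\gamma'})$ has the approximation property.
   Context: Let $(X,\|\cdot\|)$ be a normed space and $\tau$ a locally convex Hausdorff topology on $X$ coarser than (or equal to) the norm topology $\tau_{\|\cdot\|}$. The mixed topology $\gamma=\gamma(\|\cdot\|,\tau)$ is the finest linear topology on $X$ that coincides with $\tau$ on $\|\cdot\|$-bounded sets and satisfies $\tau\le\gamma\le\tau_{\|\cdot\|}$ (where $\le$ means ''coarser than''); it is locally convex and Hausdorff. The triple $(X,\|\cdot\|,\tau)$ is a Saks space if there is a directed system $\Gamma_\tau$ of continuous seminorms generating $\tau$ with $\|x\|=\sup_{q\in\Gamma_\tau}q(x)$ for all $x\in X$. It is called semi-Montel if $(X,\gamma)$ is a semi-Montel space (every bounded subset is relatively compact). For a semi-Montel Saks space, $X_\gamma'\subset(X,\|\cdot\|)'$ and $(X_\gamma',\|\cdot\|_{X_\gamma'})$ is a Banach space. Approximation property (of Schwartz): for locally convex Hausdorff spaces $Y,E$ let $Y'_\kappa$ be the dual $Y'$ with the topology of uniform convergence on absolutely convex compact subsets of $Y$, and let $Y\varepsilon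 E:=L_e(Y'_\kappa,E)$ be the space of continuous linear maps $Y'_\kappa\to E$ with the topology of uniform convergence on equicontinuous subsets of $Y'$. The tensor product $Y\otimes E$ is identified with the finite rank operators in $Y\varepsilon E$. $Y$ has the approximation property if and only if $Y\otimes E$ is dense in $Y\varepsilon E$ for all Banach spaces $E$. *)

(* Defs.v *)
From HB Require Import structures.
From mathcomp Require Import all_boot all_order all_algebra.
From mathcomp Require Import all_classical all_reals all_analysis.
From mathcomp Require Import complex.
Set Implicit Arguments.
Unset Strict Implicit.
Unset Printing Implicit Defensive.
Import Order.TTheory GRing.Theory Num.Theory.
Import numFieldTopology.Exports numFieldNormedType.Exports.
Local Open Scope classical_set_scope.
Local Open Scope ring_scope.

(* The same vector space carries several topologies (norm, tau, gamma), so a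
   topology is a first-class object, and [tspace T] is the carrier of [T]
   equipped with it. *)
Record topology (X : Type) := Topology {
  opens : set_system X;
  opensT : opens setT;
  opensI : setI_closed opens;
  opens_bigU : forall (I : Type) (f : I -> set X),
    (forall i, opens (f i)) -> opens (\bigcup_i f i)
}.

Definition tspace (K : numDomainType) (X : lmodType K) (T : topology X) : Type :=
  X.

HB.instance Definition _ (K : numDomainType) (X : lmodType K)
  (T : topology X) := GRing.Lmodule.on (tspace T).
HB.instance Definition _ (K : numDomainType) (X : lmodType K)
  (T : topology X) :=
  isOpenTopological.Build (tspace T) (@opensT X T) (@opensI X T)
    (@opens_bigU X T).

Definition coarser (X : Type) (S T : topology X) := opens S `<=` opens T.

Definition coincide_on (X : Type) (B : set X) (S T : topology X) :=
  [set U `&` B | U in opens S] = [set U `&` B | U in opens T].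

Definition normed_topology (K : numFieldType) (X : normedModType K) :
    topology X :=
  Topology (@openT X) (@openI X) (fun I f fo => @bigcup_open X I setT f
    (fun i _ => fo i)).

Section TopologyOfNormFunction.
Context (K : numFieldType) (V : lmodType K) (N : V -> K).

Definition norm_opens : set_system V :=
  [set U | forall f, U f ->
     exists2 e : K, 0 < e & forall g, N (g - f) < e -> U g].

Lemma norm_opensT : norm_opens setT.
Proof. by move=> f _; exists 1. Qed.

Lemma norm_opensI : setI_closed norm_opens.
Proof.
move=> A B oA oB f [/oA [a a0 ha] /oB [b b0 hb]].
have : (a >=< b)%O by apply: real_comparable; exact: gtr0_real.
case/orP => ab; [exists a => // g ga|exists b => // g gb].
- by split; [exact: ha|apply: hb; exact: lt_le_trans ab].
- by split; [apply: ha; exact: lt_le_trans ab|exact: hb].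
Qed.

Lemma norm_opens_bigU (I : Type) (F : I -> set V) :
  (forall i, norm_opens (F i)) -> norm_opens (\bigcup_i F i).
Proof.
move=> oF f [i _ /oF [e e0 he]]; exists e => // g /he Fg.
by exists i.
Qed.

Definition norm_topology : topology V :=
  Topology norm_opensT norm_opensI norm_opens_bigU.

End TopologyOfNormFunction.

Section LinearTopologies.
Context (K : numFieldType) (X : lmodType K).

Definition linear_topology (T : topology X) :=
  continuous (fun z : tspace T * tspace T => z.1 + z.2) /\
  continuous (fun z : K^o * tspace T => z.1 *: z.2 : tspace T).

(* Same formulation as the axiom of the library's [tvsType]. *)
Definition locally_convex_topology (T : topology X) :=
  exists2 B : set_system (tspace T),
    (forall b, b \in B -> convex_set b) & basis B.

Definition seminorm (q : X -> K) :=
  [/\ forall x, 0 <= q x,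
      forall x y, q (x + y) <= q x + q y &
      forall (a : K) x, q (a *: x) = `|a| * q x].

Definition directed (G : set (X -> K)) :=
  G !=set0 /\ forall p q, G p -> G q ->
    exists2 r, G r & forall x, p x <= r x /\ q x <= r x.

(* For a directed system the balls of single seminorms form a basis, so no
   finite intersections are needed. *)
Definition generates (G : set (X -> K)) (T : topology X) :=
  forall U : set X, opens T U <->
    forall x, U x -> exists2 q, G q &
      exists2 e : K, 0 < e & forall y, q (y - x) < e -> U y.

End LinearTopologies.

Section SaksSpaces.
Context (K : numFieldType) (X : normedModType K).

Record saks_space (tau : topology X) : Prop := SaksSpace {
  saks_linear : linear_topology tau;
  saks_convex : locally_convex_topology tau;
  saks_hausdorff : hausdorff_space (tspace tau);
  saks_coarser : coarser tau (normed_topology X);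
  saks_norm : exists G : set (X -> K),
    [/\ directed G,
        forall q, G q -> seminorm q /\ continuous (q : tspace tau -> K^o),
        generates G tau &
        forall x : X, isLub [set q x | q in G] `|x| ]
}.

Definition mixed_candidate (tau g : topology X) :=
  [/\ linear_topology g,
      coarser tau g,
      coarser g (normed_topology X) &
      forall B : set X, bounded_set B -> coincide_on B g tau].

Definition is_mixed_topology (tau gamma : topology X) :=
  mixed_candidate tau gamma /\
  forall g, mixed_candidate tau g -> coarser g gamma.

End SaksSpaces.

Section Dual.
Context (K : numFieldType) (Y : preTopologicalLmodType K).

Definition dual_pred : {pred Y -> K^o} :=
  fun f => `[< linear f /\ continuous f >].

Record dual := Dual { dual_fun :> Y -> K^o; dual_funP : dual_fun \in dual_pred }.

HB.instance Definition _ := [isSub for dual_fun].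
HB.instance Definition _ := [Choice of dual by <:].

Lemma dual_pred_submod : submod_closed dual_pred.
Proof.
split=> [|a f g /asboolP[lf cf] /asboolP[lg cg]]; apply/asboolP; split.
- by move=> b x y; rewrite /= scaler0 addr0.
- exact: cst_continuous.
- move=> b x y; rewrite -[LHS]/(a *: f _ + g _).
  rewrite -[RHS]/(b *: (a *: f x + g x) + (a *: f y + g y)).
  by rewrite lf lg !scalerDr !scalerA (mulrC a b) addrACA.
- move=> x; apply: (@cvgD K K^o); last exact: cg.
  by apply: (@cvgZr K K^o); exact: cf.
Qed.

HB.instance Definition _ :=
  GRing.isSubmodClosed.Build K (Y -> K^o) dual_pred dual_pred_submod.
HB.instance Definition _ := [SubChoice_isSubLmodule of dual by <:].

End Dual.

Section TopologicalVectorSpaces.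
Context (K : numFieldType) (Y : preTopologicalLmodType K).

Definition absolutely_convex (A : set Y) :=
  forall x y (a b : K), A x -> A y -> `|a| + `|b| <= 1 -> A (a *: x + b *: y).

(* Boundedness in the sense of von Neumann. *)
Definition tvs_bounded (B : set Y) :=
  forall U : set Y, nbhs 0 U -> exists2 r : K, 0 < r &
    forall s : K, r <= `|s| -> B `<=` [set s *: u | u in U].

Definition semi_montel :=
  forall B : set Y, tvs_bounded B -> precompact B.

(* [Y'_kappa]: uniform convergence on absolutely convex compact sets. *)
Definition dual_kappa : Type := initial_topology
  (fun f : dual Y =>
     (f : {family [set A | absolutely_convex A /\ compact A], Y -> K^o})).
HB.instance Definition _ := Topological.on dual_kappa.

End TopologicalVectorSpaces.

Section EpsProduct.
Context (K : numFieldType) (Y : preTopologicalLmodType K).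
Context (E : normedModType K).

Definition eps_pred : {pred dual Y -> E} :=
  fun u => `[< linear u /\ continuous (u : dual_kappa Y -> E) >].

Record eps_map :=
  EpsMap { eps_fun :> dual Y -> E; eps_funP : eps_fun \in eps_pred }.

HB.instance Definition _ := [isSub for eps_fun].
HB.instance Definition _ := [Choice of eps_map by <:].

Definition equicontinuous_functionals (H : set (dual Y)) :=
  equicontinuous H (fun f => f : Y -> K^o).

(* [Y eps E = L_e(Y'_kappa, E)]: uniform convergence on equicontinuous sets. *)
Definition eps_product : Type := initial_topology
  (fun u : eps_map => (u : {family equicontinuous_functionals, dual Y -> E})).
HB.instance Definition _ := Topological.on eps_product.

(* The image of the tensor product of [Y] and [E] in [Y eps E]. *)
Definition finite_rank (u : eps_product) :=
  exists (n : nat) (e : 'I_n -> E), forall f : dual Y,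
    exists c : 'I_n -> K, (u : eps_map) f = \sum_(i < n) c i *: e i.

End EpsProduct.

Definition approximation_property (K : numFieldType)
    (Y : preTopologicalLmodType K) :=
  forall E : completeNormedModType K,
    dense [set u : eps_product Y E | finite_rank u].

(* The dual of [(X, gamma)] consists of norm-continuous functionals as soon as
   [gamma] is coarser than the norm topology; only then is the set below
   bounded and the supremum meaningful. *)
Definition dual_norm (K : numFieldType) (X : normedModType K)
    (gamma : topology X) (f : dual (tspace gamma)) : K :=
  supremum 0 [set `|f x| | x in [set x : X | `|x| <= 1]].

(* Main.v *)
(* Let B be the unit ball of X and Y the dual of (X, gamma) with the dual norm.
   B is gamma-compact and gamma-compact sets are norm bounded, so the
   kappa-topology on Y, as dual of (X, gamma), is the norm topology.
   Norm-compact sets of functionals are gamma-equicontinuous, because the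
   corresponding uniform-convergence topology can be added to tau without
   leaving the class of topologies of which gamma is the finest; conversely
   gamma-equicontinuous sets lie in norm-compact ones, by compactness of B.
   Both properties are thereby equivalent to approximating the identity of Y,
   uniformly on compact sets, by operators of finite rank.
   - If such a T exists for every compact set, then an operator u on Y'_kappa,
     controlled by a compact C in Y, is approximated by z |-> u (z o T).
   - If Y has the approximation property and C in Y is compact and absolutely
     convex, approximate z |-> z|_C, with values in the closure of these
     restrictions, by a sum of c_i(z) p_i uniformly over the evaluations at
     points of B. Each c_i, composed with the evaluations, is gamma-continuous
     and hence some g_i in Y, and each p_i is close on C to some z_i in Y'; then
     f |-> sum of z_i(f) g_i is close to the identity on C.
   Only the embedding of X into Y' is needed, not that it is onto. *)
Require Import Defs.
From HB Require Import structures.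
From mathcomp Require Import all_boot all_order all_algebra.
From mathcomp Require Import all_classical all_reals all_analysis.
From mathcomp Require Import complex.
From mathcomp Require Import ring.
Set Implicit Arguments.
Unset Strict Implicit.
Unset Printing Implicit Defensive.
Import Order.TTheory GRing.Theory Num.Theory.
Import numFieldTopology.Exports numFieldNormedType.Exports.
Local Open Scope classical_set_scope.
Local Open Scope ring_scope.

(** * Suprema and ultrafilter limits in the scalar field *)

(* What the proof uses of the scalar field, which is a mere [numFieldType] in the
   theorem; suprema of nonnegative sets make [dual_norm] meaningful. *)
Record heine_borel_field (K : numFieldType) : Prop := HeineBorelField {
  hb_lub : forall A : set K, A !=set0 -> (forall x, A x -> 0 <= x) ->
    (exists M, forall x, A x -> x <= M) -> exists s, isLub A s;
  hb_arch : forall x : K, 0 <= x -> exists n, x < n%:R;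
  hb_ultra : forall (T : Type) (F : set_system T) (h : T -> K) (M : K),
    UltraFilter F -> F [set t | `|h t| <= M] ->
    exists l, forall e, 0 < e -> F [set t | `|h t - l| < e]
}.

Lemma real_heine_borel (R : realType) : heine_borel_field R.
Proof.
split.
- move=> A A0 _ [M AM]; exists (sup A); split.
    by move=> x Ax; apply: ub_le_sup => //; exists M.
  by move=> b ub; exact: ge_sup.
- move=> x x0; exists (Num.bound x); exact: archi_boundP.
- move=> T F h M UF FM.
  have PF : ProperFilter F by exact: ultra_proper.
  have FM' : F (h @^-1` `[- M, M]%classic).
    by apply: filterS FM => t /=; rewrite in_itv/= -(@ler_norml R).
  have [l [_ hl]] := @segment_compact R (- M) M (h @ F) _ FM'.
  exists l => e e0.
  (* A cluster point of an ultrafilter is a limit: otherwise the complement of the ball would belong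
     to [F] and would have to meet the ball. *)
  have [//|Fc] := in_ultra_setVsetC [set t | `|h t - l| < e] UF.
  have [|y [/= hy ly]] :=
      hl (~` [set y | `|y - l| < e]) (ball l e) _ (nbhsx_ballx _ _ e0).
    exact: Fc.
  by exfalso; apply: hy; move: ly; rewrite /ball /= distrC.
Qed.

(** Nonnegative elements of [R[i]] are real, so suprema and the Archimedean bound come from [R];
    ultrafilter limits are taken separately in the real and imaginary parts. *)
Lemma complex_heine_borel (R : realType) : heine_borel_field R[i].
Proof.
have hR := real_heine_borel R; split.
- move=> A [a0 Aa0] Age0 [M AM].
  have reA x : A x -> x = (complex.Re x)%:C%C.
    by move=> /Age0; case: x => a b; rewrite lecE /= => /andP[/eqP ->].
  have [|||s [ub lub]] := hb_lub hR (A := [set complex.Re x | x in A]).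
  + by exists (complex.Re a0), a0.
  + by move=> _ [x /Age0 + <-]; rewrite lecE => /andP[_].
  + exists (complex.Re M) => _ [x /AM + <-].
    by rewrite lecE => /andP[].
  + exists s%:C%C; split.
      move=> x Ax; rewrite (reA _ Ax) lecE /= eqxx /=.
      by apply: ub; exists x.
    move=> b bub; rewrite lecE /=; apply/andP; split.
      by have := bub _ Aa0; rewrite (reA _ Aa0) lecE /= => /andP[].
    by apply: lub => _ [x Ax <-]; have := bub _ Ax; rewrite lecE => /andP[].
- move=> [x y]; rewrite lecE /= => /andP[/eqP -> x0].
  have [n xn] := hb_arch hR x0; exists n.
  by rewrite -[n%:R](rmorph_nat (@real_complex R)) ltcE /= eqxx.
- move=> T F h M UF FM.
  have PF : ProperFilter F by exact: ultra_proper.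
  have hM t : `|h t| <= M ->
      `|complex.Re (h t)| <= complex.Re M /\ `|complex.Im (h t)| <= complex.Re M.
    rewrite normc_def lecE /= => /andP[_ le_M].
    by split; apply: le_trans le_M; rewrite -sqrtr_sqr ler_wsqrtr// ?lerDl ?lerDr sqr_ge0.
  have [a ha] : exists l, forall e, 0 < e -> F [set t | `|complex.Re (h t) - l| < e].
    by apply: (@hb_ultra _ hR T F _ (complex.Re M) UF); apply: filterS FM => t /hM[].
  have [b hb] : exists l, forall e, 0 < e -> F [set t | `|complex.Im (h t) - l| < e].
    by apply: (@hb_ultra _ hR T F _ (complex.Re M) UF); apply: filterS FM => t /hM[].
  exists (a +i* b)%C => -[e e'] /[!ltcE] /= /andP[/eqP -> e0].
  have e2 : 0 < e / 2 by rewrite divr_gt0.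
  apply: filterS2 (ha _ e2) (hb _ e2) => t /= ta tb.
  rewrite normc_def ltcE /= eqxx /=; move: ta tb.
  have -> : complex.Re (h t - (a +i* b)%C) = complex.Re (h t) - a by case: (h t).
  have -> : complex.Im (h t - (a +i* b)%C) = complex.Im (h t) - b by case: (h t).
  move: (_ - a) (_ - b) => x y xe ye.
  apply: (@le_lt_trans _ _ (`|x| + `|y|)); last by rewrite (splitr e) ltrD.
  rewrite -[leRHS]ger0_norm ?addr_ge0// -(sqrtr_sqr (`|x| + `|y|)) ler_wsqrtr//.
  rewrite -(real_normK (num_real x)) -(real_normK (num_real y)) sqrrD addrAC.
  by rewrite lerDl mulrn_wge0// mulr_ge0.
Qed.

(** The condition [0 <= M] on competing bounds accounts for empty [A], where [supremum] takes its
    default value 0. *)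
Lemma supremum0P (K : numFieldType) (A : set K) : heine_borel_field K ->
  (forall x, A x -> 0 <= x) -> (exists M, forall x, A x -> x <= M) ->
  [/\ 0 <= supremum 0 A, forall x, A x -> x <= supremum 0 A &
      forall M, 0 <= M -> (forall x, A x -> x <= M) -> supremum 0 A <= M].
Proof.
move=> hK A0 Ab; rewrite /supremum; case: ifPn => [/eqP ->|/set0P An].
  by split => //; rewrite set0E.
have [s ss] := hb_lub hK An A0 Ab.
have : supremums A (xget 0 (supremums A)).
  by apply: (@xgetPex _ 0 (supremums A)); exists s.
move: (xget _ _) => t [tub tlb]; split => //.
  by have [a Aa] := An; exact: le_trans (A0 _ Aa) (tub _ Aa).
by move=> M _ AM; exact: tlb.
Qed.

(** * Banach spaces of functions under a supremum norm *)

(* The weight [c] extends bounds on [A] to all of [T], so that a function which is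
   a limit of elements of [V] uniformly on [A] is determined on [T]. *)
Record sup_normed (K : numFieldType) (V : lmodType K) (T : Type)
    (ev : V -> T -> K) (A : set T) (c : T -> K) : Prop := SupNormed {
  sn_field : heine_borel_field K;
  sn_lin : forall a u v x, ev (a *: u + v) x = a * ev u x + ev v x;
  sn_bounded : forall v, exists M, forall x, A x -> `|ev v x| <= M;
  sn_le : forall v M, (forall x, A x -> `|ev v x| <= M) ->
    forall x, `|ev v x| <= M * c x;
  sn_weight : forall x, A x -> c x <= 1;
  sn_weight_ge0 : forall x, 0 <= c x;
  sn_inj : forall v, (forall x, ev v x = 0) -> v = 0;
  sn_closed : forall f : T -> K,
    (forall e, 0 < e -> exists v, forall x, `|f x - ev v x| <= e * c x) ->
    exists v, forall x, ev v x = f x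
}.

(** The proof [h] is part of the type, so that the norm and completeness instances below can be
    attached to this alias of [V]. *)
Definition banach_of (K : numFieldType) (V : lmodType K) (T : Type)
  (ev : V -> T -> K) (A : set T) (c : T -> K)
  (h : sup_normed ev A c) : Type := V.

Section BanachOf.
Context (K : numFieldType) (V : lmodType K) (T : Type)
  (ev : V -> T -> K) (A : set T) (c : T -> K) (h : sup_normed ev A c).
Local Notation E := (banach_of h).

HB.instance Definition _ := GRing.Lmodule.on E.

Definition sup_norm (v : V) : K := supremum 0 [set `|ev v x| | x in A].

Lemma sup_normP (v : V) :
  [/\ 0 <= sup_norm v, forall x, A x -> `|ev v x| <= sup_norm v &
      forall M, 0 <= M -> (forall x, A x -> `|ev v x| <= M) -> sup_norm v <= M].
Proof.
have [||n0 nub nlub] := @supremum0P _ [set `|ev v x| | x in A] (sn_field h).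
- by move=> _ [x _ <-].
- by have [M AM] := sn_bounded h v; exists M => _ [x Ax <-]; exact: AM.
split => // [x Ax|M M0 AM]; first by apply: nub; exists x.
by apply: nlub => // _ [x Ax <-]; exact: AM.
Qed.

Lemma sup_norm_ge0 v : 0 <= sup_norm v.
Proof. by case: (sup_normP v). Qed.

Lemma sup_norm_le v x : `|ev v x| <= sup_norm v * c x.
Proof. by apply: (sn_le h); case: (sup_normP v). Qed.

Lemma evD u v x : ev (u + v) x = ev u x + ev v x.
Proof. by have := sn_lin h 1 u v x; rewrite scale1r mul1r. Qed.

Lemma ev0 x : ev 0 x = 0.
Proof. by apply: (addrI (ev 0 x)); rewrite -evD !addr0. Qed.

Lemma evZ a v x : ev (a *: v) x = a * ev v x.
Proof. by have := sn_lin h a v 0 x; rewrite ev0 !addr0. Qed.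

Lemma evB u v x : ev (u - v) x = ev u x - ev v x.
Proof. by rewrite evD -scaleN1r evZ mulN1r. Qed.

Let ler_sup_normD u v : sup_norm (u + v) <= sup_norm u + sup_norm v.
Proof.
have [_ _] := sup_normP (u + v); apply; first by rewrite addr_ge0 ?sup_norm_ge0.
move=> x Ax; rewrite evD (le_trans (ler_normD _ _))// lerD//.
  by case: (sup_normP u) => _ + _; exact.
by case: (sup_normP v) => _ + _; exact.
Qed.

Let sup_normZ_le a v : sup_norm (a *: v) <= `|a| * sup_norm v.
Proof.
have [_ _] := sup_normP (a *: v); apply; first by rewrite mulr_ge0 ?sup_norm_ge0.
move=> x Ax; rewrite evZ normrM ler_wpM2l//.
by case: (sup_normP v) => _ + _; exact.
Qed.

Let sup_normZ a v : sup_norm (a *: v) = `|a| * sup_norm v.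
Proof.
apply/eqP; rewrite eq_le sup_normZ_le/=.
have [->|a0] := eqVneq a 0; first by rewrite normr0 mul0r sup_norm_ge0.
rewrite mulrC -ler_pdivlMr ?normr_gt0// mulrC -normfV.
by rewrite -{1}(scale1r v) -(mulVf a0) -scalerA; exact: sup_normZ_le.
Qed.

Let sup_norm_eq0 v : sup_norm v = 0 -> v = 0.
Proof.
move=> v0; apply: (sn_inj h) => x; apply/eqP; rewrite -normr_eq0 eq_le.
by rewrite normr_ge0 andbT -(mul0r (c x)) -v0 sup_norm_le.
Qed.

HB.instance Definition _ :=
  Lmodule_isNormed.Build K E ler_sup_normD sup_normZ sup_norm_eq0.

(** An ultrafilter refining [F] converges pointwise to some [g]. The Cauchy estimates, weighted by
    [c], survive the limit, so [sn_closed] places [g] in [V]; the original [F] then converges by the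
    triangle inequality. *)
Let banach_complete (F : set_system E) :
  ProperFilter F -> cauchy F -> cvg F.
Proof.
move=> PF /cauchyP cF.
have [G [UG FG]] := ultraFilterLemma PF.
have PG : ProperFilter G by exact: ultra_proper.
have Gnear (e : K) : 0 < e ->
    exists v, F (ball v e) /\ forall x, G [set w | `|ev v x - ev w x| <= e * c x].
  move=> e0; have [v Fv] := cF _ e0; exists v; split => // x.
  apply: (FG); apply: filterS Fv => w; rewrite -ball_normE /= => vw.
  rewrite -evB (le_trans (sup_norm_le _ _))// ler_wpM2r ?(sn_weight_ge0 h)//.
  exact: ltW.
have [g gP] : exists g : T -> K, forall x e, 0 < e -> G [set w | `|ev w x - g x| < e].
  suff /choice[g gP] : forall x, exists l, forall e, 0 < e -> G [set w | `|ev w x - l| < e].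
    by exists g.
  move=> x.
  have [v [_ /(_ x) Gv]] := Gnear 1 ltr01.
  apply: (hb_ultra (sn_field h) UG (M := `|ev v x| + 1 * c x)).
  apply: filterS Gv => w /=; rewrite distrC => wv.
  by rewrite -(subrK (ev v x) (ev w x)) addrC (le_trans (ler_normD _ _))// lerD2l.
have gv e v x : (forall x, G [set w | `|ev v x - ev w x| <= e * c x]) ->
    `|g x - ev v x| <= e * c x.
  move=> Gv; apply/ler_addgt0Pr => d d0.
  have [w [/= vw wg]] := filter_ex (filterI (Gv x) (gP x d d0)).
  rewrite distrC -(subrKA (ev w x)) (le_trans (ler_normD _ _))// lerD//.
  exact: ltW.
have [|v vg] := sn_closed h (f := g).
  by move=> e /Gnear[v [_ /gv vP]]; exists v => x; exact: vP.
apply/cvg_ex; exists v => B /nbhs_ballP[e /= e0 vB]; rewrite nbhs_filterE.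
have e2 : 0 < e / 2 by rewrite divr_gt0.
have [w [Fw /gv wv]] := Gnear _ e2.
apply: filterS Fw => u wu; apply: vB; rewrite -ball_normE /=.
rewrite -(subrKA w) (le_lt_trans (ler_normD _ _))// (splitr e) ler_ltD//.
  have [_ _] := sup_normP (v - w : V); apply; first exact: ltW.
  move=> x Ax; rewrite evB vg (le_trans (wv x))//.
  by rewrite ler_piMr ?(ltW e2)// (sn_weight h).
Qed.

HB.instance Definition _ := Uniform_isComplete.Build E banach_complete.

End BanachOf.

(** * Duals and the approximation property *)

(** Near-covering compactness along the filter of large constants. The order of [K] is partial, so
    two constants are dominated by their sum rather than by a maximum. *)
Lemma compact_locally_bounded (K : numFieldType) (T : topologicalType) (C : set T)
    (h : T -> K) : compact C ->
  (forall x, C x -> exists2 M, 0 <= M & nbhs x [set y | h y <= M]) ->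
  exists2 M, 0 <= M & forall y, C y -> h y <= M.
Proof.
move=> kC hC; pose F := filter_from [set M : K | 0 <= M] (fun M => [set N | M <= N]).
have FF : Filter F.
  apply: filter_from_filter; first by exists 0 => /=.
  move=> a b /= a0 b0; exists (a + b); first by rewrite /= addr_ge0.
  by move=> c /= abc; split; apply: le_trans abc; rewrite ?lerDl ?lerDr.
have [|M M0 MC] := (compact_near_coveringP C).1 kC K F (fun N y => h y <= N) FF.
  move=> x /hC[M M0 xM]; exists ([set y | h y <= M], [set N | M <= N]).
    by split => //; exists M.
  by move=> [y N] /= [yM]; exact: le_trans.
by exists M => // y Cy; apply: MC Cy => /=.
Qed.

Section LinearFacts.
Context (K : numFieldType) (V W : lmodType K) (f : V -> W) (lf : linear f).

Lemma lin0 : f 0 = 0.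
Proof. by have := lf (-1) 0 0; rewrite scaler0 addr0 scaleN1r addNr. Qed.

Lemma linZ a x : f (a *: x) = a *: f x.
Proof. by have := lf a x 0; rewrite !addr0 lin0 addr0. Qed.

Lemma linD x y : f (x + y) = f x + f y.
Proof. by have := lf 1 x y; rewrite !scale1r. Qed.

Lemma linB x y : f (x - y) = f x - f y.
Proof. by rewrite -scaleN1r linD linZ scaleN1r. Qed.

Lemma lin_sum (n : nat) (F : 'I_n -> V) : f (\sum_(i < n) F i) = \sum_(i < n) f (F i).
Proof. by elim/big_rec2: _ => [|i x y _ <-]; rewrite ?lin0// linD. Qed.

End LinearFacts.

Section FamilyInitialTopology.
Context (K : numFieldType) (S U : choiceType) (V : normedModType K)
  (fam : set U -> Prop) (h : S -> {family fam, U -> V}).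

(** [dual_kappa] and [eps_product] both have this form; this lemma and the next reduce their
    topologies to estimates on members of the family. *)
Lemma initial_family_nbhs (s : S) (A : set U) (e : K) : fam A -> 0 < e ->
  nbhs (s : initial_topology h)
    [set t | forall x, A x -> `|(h s : U -> V) x - (h t : U -> V) x| < e].
Proof.
move=> fA e0; apply: (@initial_continuous S _ h s
  [set g : U -> V | forall x, A x -> `|(h s : U -> V) x - g x| < e]).
apply: (@fam_nbhs _ _ fam A [set xy : V * V | `|xy.1 - xy.2| < e]) => //.
rewrite -entourage_ballE; exists e => //= -[x y] /=.
by rewrite -ball_normE.
Qed.

Lemma initial_family_cvg (F : set_system S) (s : S) : Filter F ->
  (forall A e, fam A -> 0 < e ->
     F [set t | forall x, A x -> `|(h s : U -> V) x - (h t : U -> V) x| < e]) ->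
  F --> (s : initial_topology h).
Proof.
move=> FF Fs B [_ [[W oW <-] Ws WB]]; rewrite nbhs_filterE.
apply: filterS WB _.
suff : (h @ F) --> h s by apply; exact: open_nbhs_nbhs.
apply/fam_cvgP => A fA P /uniform_nbhs[E [+ EP]].
rewrite -entourage_ballE => -[e /= e0 eE]; change (F (h @^-1` P)).
apply: filterS (Fs A e fA e0) => t st; apply: EP => x Ax; apply: eE => /=.
by rewrite -ball_normE; exact: st.
Qed.

End FamilyInitialTopology.

Section Dual.
Context (K : numFieldType) (Y : preTopologicalLmodType K).

Lemma dual_linear (f : dual Y) : linear f.
Proof. by have /asboolP[] := dual_funP f. Qed.

Lemma dual_continuous (f : dual Y) : continuous f.
Proof. by have /asboolP[] := dual_funP f. Qed.

Definition mk_dual (f : Y -> K^o) (lf : linear f) (cf : continuous f) : dual Y :=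
  Dual (asboolT (conj lf cf) : f \in @dual_pred K Y).

Lemma dualP (f g : dual Y) : (forall y, f y = g y) -> f = g.
Proof. by move=> fg; apply: val_inj; apply/funext. Qed.

Lemma dualE a (f g : dual Y) y : (a *: f + g) y = a * f y + g y.
Proof. by []. Qed.

Lemma dualBE (f g : dual Y) y : (f - g) y = f y - g y.
Proof. by []. Qed.

Lemma kappa_nbhs (f : dual Y) A e : absolutely_convex A -> compact A -> 0 < e ->
  nbhs (f : dual_kappa Y) [set g | forall y, A y -> `|f y - g y| < e].
Proof.
by move=> cA kA e0; exact: (@initial_family_nbhs K _ _ K^o).
Qed.

Lemma kappa_cvg (F : set_system (dual Y)) (f : dual Y) : Filter F ->
  (forall A e, absolutely_convex A -> compact A -> 0 < e ->
     F [set g : dual Y | forall y, A y -> `|f y - g y| < e]) ->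
  F --> (f : dual_kappa Y).
Proof.
move=> FF Fs; apply: (@initial_family_cvg K _ _ K^o) => A e [cA kA] e0.
exact: Fs.
Qed.

End Dual.

Section Eps.
Context (K : numFieldType) (Y : preTopologicalLmodType K) (E : normedModType K).

Lemma eps_linear (u : eps_map Y E) : linear u.
Proof. by have /asboolP[] := eps_funP u. Qed.

Lemma eps_continuous (u : eps_map Y E) : continuous (u : dual_kappa Y -> E).
Proof. by have /asboolP[] := eps_funP u. Qed.

Definition mk_eps (u : dual Y -> E) (lu : linear u)
    (cu : continuous (u : dual_kappa Y -> E)) : eps_map Y E :=
  EpsMap (asboolT (conj lu cu) : u \in @eps_pred K Y E).

Lemma kappa_continuousP (u : dual Y -> E) :
  continuous (u : dual_kappa Y -> E) <->
  forall (f : dual Y) (e : K), 0 < e ->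
    nbhs (f : dual_kappa Y) [set g : dual Y | `|u f - u g| <= e].
Proof.
by split=> cu f; have := cu f;
  move=> /(@cvgrPdist_le K E _ _ (@nbhs_filter (dual_kappa Y) f)).
Qed.

Lemma equicontinuousU (H1 H2 : set (dual Y)) :
  equicontinuous_functionals H1 -> equicontinuous_functionals H2 ->
  equicontinuous_functionals (H1 `|` H2).
Proof.
move=> e1 e2 x V eV; apply: filterS2 (e1 x V eV) (e2 x V eV) => y h1 h2 f.
by case; [exact: h1|exact: h2].
Qed.

Lemma equicontinuous_set1 (f : dual Y) : equicontinuous_functionals [set f].
Proof.
move=> x V; rewrite -entourage_ballE => -[e /= e0 eV].
have fx : \forall y \near x, ball (f x) e (f y) :=
  @dual_continuous K Y f x _ (nbhsx_ballx (f x) _ e0).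
by apply: filterS fx => y fy _ ->; exact: eV.
Qed.

End Eps.

Definition finite_rank_approximable (K : numFieldType)
    (Y : preTopologicalLmodType K) (E : normedModType K) :=
  forall (u : eps_map Y E) (H : set (dual Y)) (e : K),
    equicontinuous_functionals H -> 0 < e ->
    exists2 w : eps_map Y E, @finite_rank K Y E w &
      forall f, H f -> `|u f - w f| < e.

(** Equicontinuous sets are stable under finite unions, so the sets [B (H, e)] form a filter base.
    It converges to [u], hence every open set around [u] contains one of them. *)
Lemma approximation_propertyP (K : numFieldType) (Y : preTopologicalLmodType K) :
  approximation_property Y <->
  forall E : completeNormedModType K, finite_rank_approximable Y E.
Proof.
split=> [ap E u H e eH e0|ap E O [u Ou] oO].
  have := @initial_family_nbhs K _ _ E _ (fun u : eps_map Y E =>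
    (u : {family @equicontinuous_functionals K Y, dual Y -> E})) u H e eH e0.
  rewrite nbhsE => -[W [oW Wu] WP].
  have [w [Ww fw]] := ap E W (ex_intro _ _ Wu) oW.
  by exists w => //; exact: WP.
pose B (He : set (dual Y) * K) :=
  [set w : eps_map Y E | forall f, He.1 f -> `|u f - w f| < He.2].
pose D := [set He : set (dual Y) * K | equicontinuous_functionals He.1 /\ 0 < He.2].
have FG : Filter (filter_from D B).
  apply: filter_from_filter.
    by exists (set0, 1); split => //= x V eV; apply: filterE => y f.
  move=> [H1 e1] [H2 e2] [/= eH1 e10] [/= eH2 e20].
  exists (H1 `|` H2, Order.min e1 e2).
    split => /=; first exact: equicontinuousU.
    by rewrite comparable_lt_min ?e10 ?e20// real_comparable ?gtr0_real.
  have e12 := real_comparable (gtr0_real e10) (gtr0_real e20).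
  move=> w wP; split=> f Hf /=.
    by have := wP f (or_introl Hf); rewrite /= comparable_lt_min// => /andP[].
  by have := wP f (or_intror Hf); rewrite /= comparable_lt_min// => /andP[].
have : filter_from D B --> (u : eps_product Y E).
  apply: (@initial_family_cvg K _ _ E) => H e eH e0.
  by exists (H, e).
move=> /(_ O) []; first exact: open_nbhs_nbhs.
move=> [H e] [/= eH e0] HO.
have [w fw wP] := ap E u H e eH e0.
by exists w; split => //; exact: HO.
Qed.

(** * Coordinates of finite-rank maps *)

Section FiniteRank.
Context (K : numFieldType) (hK : heine_borel_field K) (V : lmodType K)
  (E : normedModType K).

Lemma ex_free_span (w : V -> E) (n : nat) (e : 'I_n -> E) :
  (forall v, exists c : 'I_n -> K, w v = \sum_(i < n) c i *: e i) ->
  exists (m : nat) (e' : 'I_m -> E),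
    (forall v, exists c : 'I_m -> K, w v = \sum_(i < m) c i *: e' i) /\
    forall c : 'I_m -> K, \sum_(i < m) c i *: e' i = 0 -> forall i, c i = 0.
Proof.
elim: n e => [|n IH] e we.
  by exists 0%N, e; split => // c _ [].
have [free|/existsNP[c /not_implyP[ce /existsNP[k /eqP ck]]]] := pselect
  (forall c : 'I_n.+1 -> K, \sum_(i < n.+1) c i *: e i = 0 -> forall i, c i = 0).
  by exists n.+1, e.
apply: (IH (fun j => e (lift k j))) => v.
have ek : e k = \sum_(j < n) (- (c k)^-1 * c (lift k j)) *: e (lift k j).
  move: ce; rewrite (bigD1_ord k)//= => /eqP; rewrite addr_eq0.
  move=> /eqP /(congr1 (fun x => (c k)^-1 *: x)).
  rewrite scalerA mulVf// scale1r scalerN scaler_sumr -sumrN => ->.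
  by apply: eq_bigr => j _; rewrite scalerA mulNr scaleNr.
have [d ->] := we v; exists (fun j => d k * (- (c k)^-1 * c (lift k j)) + d (lift k j)).
rewrite (bigD1_ord k)//= {1}ek scaler_sumr -big_split/=.
by apply: eq_bigr => j _; rewrite scalerA scalerDl.
Qed.

(** Otherwise there are coefficient vectors of total size 1 with arbitrarily small combinations.
    Their limit along an ultrafilter has combination 0, so it vanishes by freeness, contradicting
    the total size. *)
Lemma free_coord_bounded (n : nat) (e : 'I_n -> E) :
  (forall c : 'I_n -> K, \sum_(i < n) c i *: e i = 0 -> forall i, c i = 0) ->
  exists2 M : K, 0 <= M &
    forall c : 'I_n -> K, \sum_(i < n) `|c i| <= M * `|\sum_(i < n) c i *: e i|.
Proof.
move=> free; apply: contrapT => nM.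
have real_sum (c : 'I_n -> K) : \sum_(i < n) `|c i| \is Num.real.
  by apply: ger0_real; exact: sumr_ge0.
pose B (d : K) := [set c : 'I_n -> K |
  \sum_(i < n) `|c i| = 1 /\ `|\sum_(i < n) c i *: e i| < d].
have Bne d : 0 < d -> B d !=set0.
  move=> d0; have dV0 : 0 <= d^-1 by rewrite invr_ge0 ltW.
  have [c] : exists c : 'I_n -> K,
      d^-1 * `|\sum_(i < n) c i *: e i| < \sum_(i < n) `|c i|.
    apply: contrapT => /forallNP nc; apply: nM; exists d^-1 => // c.
    rewrite real_leNgt//; first by apply/negP.
    by apply: ger0_real; rewrite mulr_ge0.
  set S : K := \sum_(i < n) `|c i| => cS.
  have S0 : 0 < S by apply: le_lt_trans cS; rewrite mulr_ge0.
  exists (fun i => S^-1 * c i); split.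
    under eq_bigr do rewrite normrM gtr0_norm ?invr_gt0//.
    by rewrite -mulr_sumr mulVf// gt_eqF.
  under eq_bigr do rewrite -scalerA.
  rewrite -scaler_sumr normrZ gtr0_norm ?invr_gt0//.
  by rewrite ltr_pdivrMl// mulrC -ltr_pdivrMl.
have PF : ProperFilter (filter_from [set d : K | 0 < d] B).
  apply: filter_from_proper Bne.
  apply: filter_from_filter; first by exists 1 => /=.
  move=> a b /= a0 b0; exists (Order.min a b).
    by rewrite /= comparable_lt_min ?a0 ?b0// real_comparable ?gtr0_real.
  have ab := real_comparable (gtr0_real a0) (gtr0_real b0).
  by move=> c [c1]; rewrite comparable_lt_min// => /andP[ca cb].
have [G [UG FG]] := ultraFilterLemma PF.
have PG : ProperFilter G by exact: ultra_proper.
have GB d : 0 < d -> G (B d) by move=> d0; apply: FG; exists d.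
have /choice[l lP] : forall i : 'I_n, exists l, forall d, 0 < d -> G [set c | `|c i - l| < d].
  move=> i; apply: (hb_ultra hK UG (M := 1)).
  apply: filterS (GB _ ltr01) => c [/= <- _].
  by rewrite (bigD1 i)//= lerDl sumr_ge0.
have lG d : 0 < d -> G [set c | forall i, `|c i - l i| < d].
  by move=> d0; apply: filter_forall => i; exact: lP.
have l0 : \sum_(i < n) l i *: e i = 0.
  apply/eqP; rewrite -normr_eq0 eq_le normr_ge0 andbT.
  apply/ler_addgt0Pr => d d0; rewrite add0r.
  pose N := \sum_(i < n) `|e i|.
  have N0 : 0 < N + 1 by rewrite ltr_wpDl// sumr_ge0.
  have d'0 : 0 < d / (N + 1) by rewrite divr_gt0.
  have [c [/= [_ ce] cl]] := filter_ex (filterI (GB _ d'0) (lG _ d'0)).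
  rewrite -(subKr (\sum_(i < n) c i *: e i) (\sum_(i < n) l i *: e i)).
  rewrite (le_trans (ler_normB _ _))// -(divfK (lt0r_neq0 N0) d) mulrDr mulr1 [leRHS]addrC.
  apply: lerD; first exact: ltW.
  rewrite -sumrB (le_trans (ler_norm_sum _ _ _))// mulr_sumr ler_sum// => i _.
  by rewrite -scalerBl normrZ ler_wpM2r// ltW.
have li i : l i = 0 by exact: free.
(* With each of the [n] coefficients at most [1 / (n + 1)], the sum stays below 1, also when
   [n = 0]. *)
have n0 : 0 < (n.+1%:R)^-1 :> K by rewrite invr_gt0 ltr0n.
have [c [/= [c1 _] cl]] := filter_ex (filterI (GB _ ltr01) (lG _ n0)).
suff : \sum_(i < n) `|c i| < 1 by rewrite c1 ltxx.
apply: (@le_lt_trans _ _ (\sum_(i < n) (n.+1%:R)^-1)).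
  by apply: ler_sum => i _; have := cl i; rewrite li subr0 => /ltW.
by rewrite sumr_const card_ord -[_ *+ n]mulr_natl ltr_pdivrMr ?ltr0n// mul1r ltr_nat.
Qed.

(** The coefficients in [finite_rank] are chosen separately for each argument. Over a free family
    they are unique, hence linear, and bounded by the norm of the value. *)
Lemma finite_rank_coord (w : V -> E) (n : nat) (e : 'I_n -> E) : linear w ->
  (forall v, exists c : 'I_n -> K, w v = \sum_(i < n) c i *: e i) ->
  exists (m : nat) (e' : 'I_m -> E) (c : 'I_m -> V -> K) (M : K),
    [/\ forall v, w v = \sum_(i < m) c i v *: e' i,
        forall i a u v, c i (a *: u + v) = a * c i u + c i v &
        0 <= M /\ forall i v, `|c i v| <= M * `|w v|].
Proof.
move=> lw /ex_free_span[m [e' [/choice[c wc] free]]].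
have [M M0 Mc] := free_coord_bounded free.
exists m, e', (fun i v => c v i), M; split=> // [i a u v|].
  apply/eqP; rewrite -subr_eq0; apply/eqP; move: i; apply: free.
  under eq_bigr do rewrite scalerBl scalerDl -scalerA.
  by rewrite sumrB big_split/= -scaler_sumr -!wc lw subrr.
split=> // i v; rewrite wc (le_trans _ (Mc _))//.
by rewrite (bigD1 i)//= lerDl sumr_ge0.
Qed.

End FiniteRank.

(** * The Banach space of uniform limits of functionals on a compact set *)

Section DualClosure.
Context (K : numFieldType) (hK : heine_borel_field K) (Y : preTopologicalLmodType K).
Context (C : set Y).

(* The closure, rather than all bounded functions on [C], because elements of a
   finite-rank range must be approximable on [C] by continuous functionals. *)
Definition dual_closure_pred : {pred Y -> K^o} := fun f =>
  `[< (forall y, ~ C y -> f y = 0) /\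
      forall e : K, 0 < e -> exists z : dual Y, forall y, C y -> `|f y - z y| <= e >].

Record dual_closure :=
  DualClosure { dual_closure_fun :> Y -> K^o; _ : dual_closure_fun \in dual_closure_pred }.

HB.instance Definition _ := [isSub for dual_closure_fun].
HB.instance Definition _ := [Choice of dual_closure by <:].

Lemma dual_closure_submod : submod_closed dual_closure_pred.
Proof.
split=> [|a f g /asboolP[f0 fC] /asboolP[g0 gC]]; apply/asboolP; split => //.
- by move=> e e0; exists 0 => y _; rewrite subrr normr0 ltW.
- by move=> y Cy; rewrite -[LHS]/(a * f y + g y) f0// g0// mulr0 addr0.
- move=> e e0; have a10 : 0 < `|a| + 1 by rewrite ltr_wpDl.
  have d0 : 0 < e / (`|a| + 1) by rewrite divr_gt0.
  have [z zP] := fC _ d0; have [t tP] := gC _ d0; exists (a *: z + t) => y Cy.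
  rewrite -[X in X - _]/(a * f y + g y) dualE.
  rewrite -(divfK (lt0r_neq0 a10) e); move: d0 zP tP; set d := e / _ => d0 zP tP.
  have -> : a * f y + g y - (a * z y + t y) = a * (f y - z y) + (g y - t y) :> K by ring.
  rewrite (le_trans (ler_normD _ _))// [leRHS]mulrDr mulr1 lerD ?tP// normrM mulrC.
  by rewrite ler_wpM2r ?zP.
Qed.

HB.instance Definition _ :=
  GRing.isSubmodClosed.Build K (Y -> K^o) dual_closure_pred dual_closure_submod.
HB.instance Definition _ := [SubChoice_isSubLmodule of dual_closure by <:].

Lemma dual_closureP (f : dual_closure) :
  (forall y, ~ C y -> f y = 0) /\
  forall e : K, 0 < e -> exists z : dual Y, forall y, C y -> `|f y - z y| <= e.
Proof. by case: f => f /= /asboolP. Qed.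

Lemma dual_closure_restr_pred (z : dual Y) :
  ((fun y => if `[< C y >] then z y else 0) : Y -> K^o) \in dual_closure_pred.
Proof.
apply/asboolP; split => [y /asboolPn/negPf -> //|e e0].
by exists z => y /asboolP ->; rewrite subrr normr0 ltW.
Qed.

Definition dual_closure_restr (z : dual Y) : dual_closure :=
  DualClosure (dual_closure_restr_pred z).

Lemma dual_closure_restrE z y : C y -> dual_closure_restr z y = z y.
Proof. by rewrite /= => /asboolP ->. Qed.

Lemma dual_closure_restr_linear : linear dual_closure_restr.
Proof.
move=> a z t; apply: val_inj; apply/funext => y /=.
rewrite -[RHS]/(a * (if `[< C y >] then z y else 0) + (if `[< C y >] then t y else 0)).
by case: ifP => // _; rewrite mulr0 addr0.
Qed.

(** The weight is the indicator of [C], matching the convention that the functions vanish off [C].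
    Boundedness holds because continuous functionals are bounded on compact sets. *)
Lemma dual_closure_sup_normed : compact C ->
  sup_normed (fun (f : dual_closure) y => f y : K) C (fun y => (`[< C y >])%:R).
Proof.
move=> kC; split => //.
- move=> f; have [_ /(_ _ ltr01)[z zP]] := dual_closureP f.
  have [M M0 zM] : exists2 M : K, 0 <= M & forall y, C y -> `|z y| <= M.
    apply: compact_locally_bounded kC _ => y Cy; exists (`|z y| + 1); first by rewrite addr_ge0.
    have /cvgrPdist_le /(_ 1 ltr01) := @dual_continuous K Y z y.
    apply: filterS => t; rewrite distrC => tP; rewrite /= -(subrK (z y) (z t)).
    by rewrite (le_trans (ler_normD _ _))// addrC lerD2l.
  exists (1 + M) => y Cy.
  by rewrite -(subrK (z y) (f y)) (le_trans (ler_normD _ _))// lerD ?zP ?zM.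
- move=> f M fM y; have [/asboolP Cy|/asboolP Cy] := boolP `[< C y >].
    by rewrite mulr1 fM.
  by have [-> // _] := dual_closureP f; rewrite normr0 mulr0.
- by move=> y Cy; case: `[< _ >].
- by move=> f f0; apply: val_inj; apply/funext.
- move=> f fP; have fS : (f : Y -> K^o) \in dual_closure_pred.
    apply/asboolP; split => [y /asboolPn/negPf Cy|e e0].
      have [g] := fP 1 ltr01; move=> /(_ y); rewrite Cy mulr0 normr_le0 subr_eq0 => /eqP ->.
      by have [-> //] := dual_closureP g; apply/asboolPn; rewrite Cy.
    have e2 : 0 < e / 2 by rewrite divr_gt0.
    have [g gP] := fP _ e2; have [_ /(_ _ e2)[z zP]] := dual_closureP g.
    exists z => y Cy; rewrite -(subrKA (g y)) (le_trans (ler_normD _ _))// (splitr e) lerD ?zP//.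
    by rewrite (le_trans (gP y))//; move/asboolP: Cy => ->; rewrite mulr1.
  by exists (DualClosure fS).
Qed.

End DualClosure.

(** * Maps on the dual controlled by one compact set *)

Section KappaBound.
Context (K : numFieldType) (Y : preTopologicalLmodType K) (E : normedModType K).

(** The filter of smallness on arbitrary compact sets converges to 0 in [dual_kappa]. Compact sets
    are stable under union, so no absolutely convex hull has to be formed; homogeneity then gives
    the bound. *)
Lemma eps_compact_bound (u : eps_map Y E) :
  exists2 C : set Y, compact C & exists2 M : K, 0 <= M &
    forall (z : dual Y) (s : K), 0 < s -> (forall y, C y -> `|z y| <= s) ->
      `|u z| <= M * s.
Proof.
pose D := [set Ce : set Y * K | compact Ce.1 /\ 0 < Ce.2].
pose F := filter_from D (fun Ce => [set z : dual Y | forall y, Ce.1 y -> `|z y| < Ce.2]).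
have FF : Filter F.
  apply: filter_from_filter.
    by exists (set0, 1); split => //=; exact: compact0.
  move=> [C1 e1] [C2 e2] [/= k1 e10] [/= k2 e20].
  have e12 := real_comparable (gtr0_real e10) (gtr0_real e20).
  exists (C1 `|` C2, Order.min e1 e2).
    by split => /=; [exact: compactU|rewrite comparable_lt_min// e10].
  move=> z zP; split=> y Cy /=.
    by have := zP y (or_introl Cy); rewrite /= comparable_lt_min// => /andP[].
  by have := zP y (or_intror Cy); rewrite /= comparable_lt_min// => /andP[].
have : F --> (0 : dual_kappa Y).
  apply: kappa_cvg => A e _ kA e0; exists (A, e) => // z zP y Ay.
  by rewrite sub0r normrN; exact: zP.
have /kappa_continuousP/(_ 0 _ ltr01) u1 := @eps_continuous _ _ _ u.
move=> /(_ _ u1); rewrite (lin0 (eps_linear u)).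
move=> [[C e] [/= kC e0] CE]; exists C => //; exists (2 / e).
  by rewrite divr_ge0// ltW.
move=> z s s0 zs; pose a := e / 2 / s.
have a0 : 0 < a by rewrite !divr_gt0.
have := CE (a *: z); rewrite /= sub0r normrN (linZ (eps_linear u)) (normrZ a) (gtr0_norm a0).
have -> : 2 / e * s = a^-1 * 1 by rewrite mulr1 /a invfM invf_div invrK.
rewrite ler_pdivlMl//; apply => y Cy.
change (`|a * z y| < e); rewrite normrM (gtr0_norm a0).
apply: (@le_lt_trans _ _ (a * s)); first by rewrite ler_pM2l// zs.
by rewrite /a divfK ?gt_eqF// ltr_pdivrMr// mulr_natr mulr2n ltrDl.
Qed.

End KappaBound.

(** * The mixed topology and its dual *)

Lemma nbhs0_norm_ltP (K : numFieldType) (V : normedModType K) (A : set V) :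
  nbhs (0 : V) A <-> exists2 d : K, 0 < d & forall x, `|x| < d -> A x.
Proof. by split => [/nbhs_norm0P[d d0 dA]|[d d0 dA]]; [exists d|apply/nbhs_norm0P; exists d]. Qed.

Lemma nbhs_tspaceS (K : numDomainType) (X : lmodType K) (T : topology X)
    (x : tspace T) (A B : set X) : A `<=` B -> nbhs x A -> nbhs x B.
Proof. by move=> AB [V [oV Vx VA]]; exists V; split=> // y /VA /AB. Qed.

Lemma open_tspaceE (K : numDomainType) (X : lmodType K) (T : topology X)
    (A : set X) : open (A : set (tspace T)) = opens T A.
Proof. by []. Qed.

(** Rescaling [x] to norm [d / 2] puts it strictly inside the ball where [f] is bounded by 1; this
    is the source of the factor 2. *)
Lemma linear_bound (K : numFieldType) (V W : normedModType K) (f : V -> W) (d : K) :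
  linear f -> 0 < d -> (forall x, `|x| < d -> `|f x| <= 1) ->
  forall x, `|f x| <= 2 / d * `|x|.
Proof.
move=> lf d0 fd x.
have [->|x0] := eqVneq x 0; first by rewrite (lin0 lf) !normr0 mulr0.
have nx0 : 0 < `|x| by rewrite normr_gt0.
pose a := d / 2 / `|x|.
have a0 : 0 < a by rewrite !divr_gt0.
have := fd (a *: x); rewrite (linZ lf) (normrZ a (f x)) (normrZ a x).
rewrite (gtr0_norm a0) /a divfK ?gt_eqF//.
rewrite ltr_pdivrMr// mulr_natr mulr2n ltrDl => /(_ d0).
have -> : 2 / d * `|x| = a^-1 * 1 by rewrite mulr1 /a invfM invf_div invrK.
by rewrite ler_pdivlMl.
Qed.

Section Saks.
Context (K : numFieldType) (hK : heine_borel_field K) (X : normedModType K).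
Context (tau gamma : topology X) (G : set (X -> K)).
Context (dG : directed G)
  (Gs : forall q, G q -> seminorm q) (genG : generates G tau)
  (Gn : forall x : X, isLub [set q x | q in G] `|x|)
  (hgamma : is_mixed_topology tau gamma).

Lemma seminorm0 (p : X -> K) : seminorm p -> p 0 = 0.
Proof. by case=> _ _ pZ; have := pZ 0 0; rewrite scale0r normr0 mul0r. Qed.

Lemma seminormN (p : X -> K) x : seminorm p -> p (- x) = p x.
Proof. by case=> _ _ pZ; rewrite -scaleN1r pZ normrN1 mul1r. Qed.

Lemma saks_seminorm_le q x : G q -> q x <= `|x|.
Proof. by move=> Gq; have [+ _] := Gn x; apply; exists q. Qed.

(** * Neighbourhoods for the mixed topology *)

Section MixedNeighbourhood.
Context (Q : set (X -> K)) (M : K).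
Context (Qs : forall p, Q p -> seminorm p) (M0 : 0 <= M)
  (QM : forall p x, Q p -> p x <= M * `|x|)
  (Qt : forall r e, 0 < e -> exists2 q, G q & exists2 d, 0 < d &
     forall x, `|x| <= r -> q x < d -> forall p, Q p -> p x <= e).

(* [max (q y) (sup_Q p y) < e], avoiding the supremum. *)
Let near0 (q : X -> K) (e : K) (y : X) :=
  exists e', [/\ e' < e, q y <= e' & forall p, Q p -> p y <= e'].

Let near0_0 q e : G q -> 0 < e -> near0 q e 0.
Proof.
move=> Gq e0; exists 0; split => //; first by rewrite seminorm0//; exact: Gs.
by move=> p Qp; rewrite seminorm0//; exact: Qs.
Qed.

Let near0_le q1 q2 e1 e2 y :
  e1 <= e2 -> q2 y <= q1 y -> near0 q1 e1 y -> near0 q2 e2 y.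
Proof.
move=> e12 q12 [e' [e'e qy py]]; exists e'; split => //; first exact: lt_le_trans e12.
exact: le_trans qy.
Qed.

Let near0D q e1 e2 x y : G q ->
  near0 q e1 x -> near0 q e2 y -> near0 q (e1 + e2) (x + y).
Proof.
move=> Gq [f1 [fe1 qx px]] [f2 [fe2 qy py]]; exists (f1 + f2); split.
- exact: ltrD.
- by have [_ + _] := Gs Gq => /(_ x y) /le_trans; apply; exact: lerD.
- move=> p Qp; have [_ + _] := Qs Qp => /(_ x y) /le_trans; apply.
  by apply: lerD; [exact: px|exact: py].
Qed.

Let near0Z q a s e y : G q -> near0 q s y -> 0 < e -> `|a| * s <= e ->
  near0 q e (a *: y).
Proof.
move=> Gq [s' [s's qy py]] e0 ase; exists (`|a| * s'); split.
- have [->|a0] := eqVneq a 0; first by rewrite normr0 mul0r.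
  by apply: lt_le_trans ase; rewrite ltr_pM2l// normr_gt0.
- by have [_ _ ->] := Gs Gq; exact: ler_wpM2l.
- by move=> p Qp; have [_ _ ->] := Qs Qp; apply: ler_wpM2l => //; exact: py.
Qed.

Let near0_norm q e y : G q -> (M + 1) * `|y| < e -> near0 q e y.
Proof.
move=> Gq ye; exists ((M + 1) * `|y|); split => //.
  by rewrite (le_trans (saks_seminorm_le _ Gq))// ler_peMl// lerDr.
by move=> p Qp; rewrite (le_trans (QM _ Qp))// ler_wpM2r// lerDl.
Qed.

(* Adding the seminorms of [Q] to [tau] changes nothing on bounded sets, so the
   resulting topology is coarser than [gamma] by maximality. *)
Let ref_opens : set_system X := [set U | forall x, U x ->
  exists2 q, G q & exists2 e, 0 < e & forall y, near0 q e (y - x) -> U y].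

Let ref_opensT : ref_opens setT.
Proof. by move=> x _; have [[q Gq] _] := dG; exists q => //; exists 1. Qed.

Let ref_opensI : setI_closed ref_opens.
Proof.
move=> A B oA oB x [/oA[q1 G1 [e1 e10 A1]] /oB[q2 G2 [e2 e20 B2]]].
have [_ /(_ _ _ G1 G2)[q Gq q12]] := dG.
have e12 := real_comparable (gtr0_real e10) (gtr0_real e20).
exists q => //; exists (Order.min e1 e2); first by rewrite comparable_lt_min// e10.
move=> y yx; split; [apply: A1|apply: B2]; apply: near0_le yx.
- by rewrite comparable_ge_min// lexx.
- by case: (q12 (y - x)).
- by rewrite comparable_ge_min// lexx orbT.
- by case: (q12 (y - x)).
Qed.

Let ref_opens_bigU (I : Type) (f : I -> set X) :
  (forall i, ref_opens (f i)) -> ref_opens (\bigcup_i f i).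
Proof.
move=> fo x [i _ /fo[q Gq [e e0 fe]]]; exists q => //; exists e => // y /fe.
by exists i.
Qed.

Let refined : topology X := Topology ref_opensT ref_opensI ref_opens_bigU.

Let ref_ball q e x : G q -> ref_opens [set y | near0 q e (y - x)].
Proof.
move=> Gq y [e' [e'e qy py]]; exists q => //; exists (e - e'); first by rewrite subr_gt0.
move=> z [f' [f'e qz pz]]; exists (f' + e'); split.
- by rewrite -ltrBrDr.
- have [_ + _] := Gs Gq => /(_ (z - y) (y - x)); rewrite subrKA => /le_trans; apply.
  exact: lerD.
- move=> p Qp; have [_ + _] := Qs Qp => /(_ (z - y) (y - x)); rewrite subrKA => /le_trans; apply.
  by apply: lerD; [exact: pz|exact: py].
Qed.

Let nbhs_ref_ball q e (x : X) : G q -> 0 < e ->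
  nbhs (x : tspace refined) [set y | near0 q e (y - x)].
Proof.
move=> Gq e0; exists [set y | near0 q e (y - x)]; split => //; first exact: ref_ball.
by rewrite /= subrr; exact: near0_0.
Qed.

Let refined_linear : linear_topology refined.
Proof.
split.
  move=> [x y] A [U [oU Uxy UA]]; have [q Gq [e e0 eU]] := oU _ Uxy.
  have e2 : 0 < e / 2 by rewrite divr_gt0.
  exists ([set x' | near0 q (e / 2) (x' - x)], [set y' | near0 q (e / 2) (y' - y)]).
    by split; exact: nbhs_ref_ball.
  move=> [x' y'] /= [x'x y'y]; apply: UA; apply: eU.
  by rewrite (splitr e) opprD addrACA; exact: near0D.
move=> [a x] A [U [oU Uxy UA]]; have [q Gq [e e0 eU]] := oU _ Uxy.
have e2 : 0 < e / 2 by rewrite divr_gt0.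
(* As [s] exceeds [(M + 1) * |x|], the vector [x] satisfies [near0 q s x]. This controls the second
   term of b y - a x = b (y - x) + (b - a) x. *)
pose s := (M + 1) * `|x| + 1.
have s0 : 0 < s by rewrite ltr_wpDl// mulr_ge0// addr_ge0.
have a10 : 0 < `|a| + 1 by rewrite ltr_wpDl.
exists ([set b | `|b - a| < Order.min 1 (e / 2 / s)],
        [set y | near0 q (e / 2 / (`|a| + 1)) (y - x)]).
  split => /=; last by apply: nbhs_ref_ball => //; rewrite divr_gt0.
  have m0 : 0 < Order.min 1 (e / 2 / s).
    by rewrite comparable_lt_min ?ltr01 ?divr_gt0// real_comparable ?gtr0_real ?divr_gt0.
  apply: filterS (nbhsx_ballx (a : K^o) _ m0) => b /=.
  by rewrite -ball_normE /= distrC.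
move=> [b y] /= [ba yx]; apply: UA; apply: eU.
rewrite -(subrKA (b *: x)) -scalerBr -scalerBl (splitr e).
move: ba; rewrite comparable_lt_min; last by rewrite real_comparable ?gtr0_real ?divr_gt0.
move=> /andP[ba1 bas].
have bn : `|b| <= `|a| + 1.
  by rewrite -(subrK a b) (le_trans (ler_normD _ _))// addrC lerD2l ltW.
apply: near0D => //.
  by apply: near0Z yx _ _ => //; rewrite mulrCA ler_piMr ?(ltW e2)// ler_pdivrMr// mul1r.
apply: (@near0Z q _ s) => //; last by rewrite -ler_pdivlMr// ltW.
by apply: near0_norm => //; rewrite /s ltrDl.
Qed.

Let refined_mixed : mixed_candidate tau refined.
Proof.
split; first exact: refined_linear.
- move=> U /genG oU x Ux; have [q Gq [e e0 eU]] := oU _ Ux.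
  by exists q => //; exists e => // y [e' [e'e qy _]]; apply: eU; exact: le_lt_trans e'e.
- move=> U oU; rewrite /normed_topology/= openE => x Ux.
  have [q Gq [e e0 eU]] := oU _ Ux.
  have M10 : 0 < M + 1 by rewrite ltr_wpDl.
  have d0 : 0 < e / (M + 1) by rewrite divr_gt0.
  apply: filterS (nbhsx_ballx x _ d0) => y; rewrite -ball_normE /= distrC => yx.
  by apply: eU; apply: near0_norm => //; rewrite mulrC -ltr_pdivlMr.
- move=> B /pinfty_ex_gt0[r r0 Br]; apply/seteqP; split=> _ [U oU <-]; last first.
    exists U => //; move: oU => /genG oU x Ux; have [q Gq [e e0 eU]] := oU _ Ux.
    by exists q => //; exists e => // y [e' [e'e qy _]]; apply: eU; exact: le_lt_trans e'e.
  (* The largest [tau]-open set whose trace on [B] lies in [U]; it remains to see that it covers all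
     of that trace. *)
  exists (\bigcup_(V in [set V | opens tau V /\ V `&` B `<=` U]) V).
    rewrite bigcup_mkcond; apply: opens_bigU => V; case: ifPn => [|_].
      by rewrite inE => -[].
    by apply/genG.
  apply/seteqP; split => x; first by move=> [[V [oV VB] Vx] Bx]; split => //; exact: VB.
  move=> [Ux Bx]; split => //.
  have [q1 G1 [e e0 eU]] := oU _ Ux.
  have e2 : 0 < e / 2 by rewrite divr_gt0.
  (* Differences of points of [B] have norm at most [r + r]. *)
  have [q2 G2 [d d0 dP]] := Qt (r + r) e2.
  have [_ /(_ _ _ G1 G2)[q Gq q12]] := dG.
  have ed := real_comparable (gtr0_real e2) (gtr0_real d0).
  have m0 : 0 < Order.min (e / 2) d by rewrite comparable_lt_min// e2.
  exists [set y | q (y - x) < Order.min (e / 2) d]; last first.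
    by rewrite /= subrr seminorm0//; exact: Gs.
  split.
    apply/genG => y /= yx; exists q => //; exists (Order.min (e / 2) d - q (y - x)).
      by rewrite subr_gt0.
    move=> z; rewrite ltrBrDr; apply: le_lt_trans.
    by rewrite -(subrKA y z); have [_ + _] := Gs Gq; apply.
  move=> y [/= + By]; rewrite comparable_lt_min// => /andP[ye yd].
  have [qy1 qy2] := q12 (y - x).
  apply: eU; exists (e / 2); split.
  + by rewrite ltr_pdivrMr// mulr_natr mulr2n ltrDl.
  + by rewrite (le_trans qy1)// ltW.
  + apply: dP; last exact: le_lt_trans yd.
    by rewrite (le_trans (ler_normB _ _))// lerD//; exact: Br.
Qed.

(** Continuity for [gamma] thus has to be tested only on norm-bounded sets. It is applied below to
    uniform limits of functionals, to compact sets of functionals and to a sequence of weighted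
    seminorms. *)
Lemma mixed_nbhs (x : X) (e : K) : 0 < e ->
  nbhs (x : tspace gamma) [set y | forall p, Q p -> p (y - x) <= e].
Proof.
move=> e0; have [[q Gq] _] := dG.
exists [set y | near0 q e (y - x)]; split.
- by have [_] := hgamma; apply; [exact: refined_mixed|exact: ref_ball].
- by rewrite /= subrr; exact: near0_0.
- by move=> y [e' [e'e _ py]] p Qp; rewrite (le_trans (py _ Qp))// ltW.
Qed.

End MixedNeighbourhood.

Lemma gamma_nbhs0_norm (U : set X) : nbhs (0 : tspace gamma) U ->
  exists2 d : K, 0 < d & forall x : X, `|x| < d -> U x.
Proof.
move=> [V [oV V0 VU]]; have [[_ _ cg _] _] := hgamma.
have /nbhs_norm0P[d /= d0 dV] : nbhs (0 : X) V.
  by apply: open_nbhs_nbhs; split => //; exact: cg.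
by exists d => // x xd; apply: VU; exact: dV.
Qed.

Lemma gamma_nbhs_scale (U : set X) (x : X) (a : K) : nbhs (0 : tspace gamma) U ->
  nbhs (x : tspace gamma) [set y : X | U (a *: (y - x))].
Proof.
have [[[cD cZ] _ _ _] _] := hgamma => U0.
have := cZ (a, 0) U; rewrite /= scaler0 => /(_ U0)[[A B] /= [aA B0] AB].
have := cD (x, - x) B; rewrite /= subrr => /(_ B0)[[A' B'] /= [xA' xB'] AB'].
apply: nbhs_tspaceS xA' => y A'y; apply: (AB (a, y - x)); split=> /=.
  exact: nbhs_singleton.
by apply: (AB' (y, - x)); split=> //=; exact: nbhs_singleton xB'.
Qed.

(** * The dual of the mixed topology as a Banach space *)

Local Notation P := (dual (tspace gamma)).

Lemma gamma_dual_continuous (f : X -> K^o) : linear f ->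
  (forall (x : X) (e : K), 0 < e ->
     nbhs (x : tspace gamma) [set y : X | `|f (y - x)| <= e]) ->
  continuous (f : tspace gamma -> K^o).
Proof.
move=> lf nf x.
suff : forall e : K, 0 < e -> \forall y \near (x : tspace gamma), `|f x - f y| <= e.
  by move=> /(@cvgrPdist_le K K^o _ _ (@nbhs_filter (tspace gamma) x)).
move=> e e0; apply: nbhs_tspaceS (nf x e e0) => y /=.
by rewrite distrC (linB lf).
Qed.

(** As [gamma] is coarser than the norm topology, its zero neighbourhoods contain norm balls. Hence
    the set defining [dual_norm] is bounded. *)
Lemma gamma_dual_bound (f : P) : exists2 M : K, 0 <= M & forall x : X, `|f x| <= M * `|x|.
Proof.
have f0 : f 0 = 0 := lin0 (dual_linear f).
have : nbhs (0 : tspace gamma) [set x : X | `|f x| <= 1].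
  have /cvgrPdist_le /(_ 1 ltr01) := @dual_continuous K _ f 0.
  by apply: filterS => x /=; rewrite f0 sub0r normrN.
move=> /gamma_nbhs0_norm[d d0 df]; exists (2 / d); first by rewrite divr_ge0// ltW.
exact: (@linear_bound K X K^o f d (dual_linear f) d0 df).
Qed.

Lemma gamma_dual_tau (f : P) (r e : K) : 0 < e -> exists2 q, G q & exists2 d, 0 < d &
  forall x, `|x| <= r -> q x < d -> `|f x| <= e.
Proof.
move=> e0; have [[_ _ _ cB] _] := hgamma.
have f0 : f 0 = 0 := lin0 (dual_linear f).
(* If [0 <= r] fails, possibly because [r] is not real, no vector has norm at most [r]. *)
have [r0|r0] := boolP (0 <= r); last first.
  have [[q Gq] _] := dG; exists q => //; exists 1 => // x xr.
  by case/negP: r0; exact: le_trans xr.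
have bB : bounded_set [set x : X | `|x| <= r].
  exists r; split; first exact: ger0_real.
  by move=> s rs x /= xr; rewrite (le_trans xr)// ltW.
have oU : opens gamma [set x : X | `|f x| < e].
  rewrite -open_tspaceE -[X in open X]/((f : tspace gamma -> K^o) @^-1` [set y | `|y| < e]).
  apply: open_comp => [x _|]; first exact: dual_continuous.
  have -> : [set y : K^o | `|y| < e] = ball (0 : K^o) e.
    by rewrite -ball_normE; apply/seteqP; split => y /=; rewrite sub0r normrN.
  exact: ball_open.
have [V oV VU] : [set V `&` [set x : X | `|x| <= r] | V in opens tau]
    ([set x : X | `|f x| < e] `&` [set x : X | `|x| <= r]).
  by rewrite -(cB _ bB); exists [set x : X | `|f x| < e].
have V0 : V 0.
  by have [] : (V `&` [set x : X | `|x| <= r]) 0 by rewrite VU /= f0 !normr0.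
have [q Gq [d d0 dV]] := (genG V).1 oV 0 V0.
exists q => //; exists d => // x xr; rewrite -{1}(subr0 x) => /dV Vx; apply/ltW.
by have [] : ([set x : X | `|f x| < e] `&` [set x : X | `|x| <= r]) x by rewrite -VU.
Qed.

(** By homogeneity the norm of [X] is the weight. A uniform limit of functionals is linear; on each
    ball it is close to a functional that is [tau]-small near 0, so [mixed_nbhs] makes it
    [gamma]-continuous. *)
Lemma gamma_dual_sup_normed :
  sup_normed (fun (f : P) (x : X) => f x : K) [set x : X | `|x| <= 1] (fun x => `|x|).
Proof.
split=> //.
- move=> f; have [M M0 fM] := gamma_dual_bound f; exists M => x /= x1.
  by rewrite (le_trans (fM x))// ler_piMr.
- move=> f M fM x; have fZ a y : f (a *: y) = a * f y := linZ (dual_linear f) a y.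
  have [->|x0] := eqVneq x 0.
    by have := fZ 0 0; rewrite scale0r mul0r => ->; rewrite !normr0 mulr0.
  have nx0 : 0 < `|x| by rewrite normr_gt0.
  have := fM (`|x|^-1 *: x); rewrite /= (normrZ (`|x|^-1) x) fZ normrM.
  rewrite normfV normr_id mulVf ?gt_eqF// => /(_ (lexx _)).
  by rewrite ler_pdivrMl// mulrC.
- by move=> f f0; exact: dualP.
- move=> g gP.
  have lg : linear (g : X -> K^o).
    move=> a x y; change (g (a *: x + y) = a * g x + g y :> K).
    apply/eqP; rewrite -subr_eq0 -normr_eq0 eq_le normr_ge0 andbT.
    apply/ler_addgt0Pr => e e0; rewrite add0r.
    (* The total weight of the three approximation errors, at [a *: x + y], [x] and [y]. *)
    pose N := `|a *: x + y| + (`|a| * `|x| + `|y|).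
    have N0 : 0 < N + 1 by rewrite ltr_wpDl// !addr_ge0// mulr_ge0.
    have d0 : 0 < e / (N + 1) by rewrite divr_gt0.
    have [v vP] := gP _ d0.
    have vl : v (a *: x + y) = a * v x + v y :> K := dual_linear v a x y.
    rewrite -(divfK (lt0r_neq0 N0) e).
    have -> : g (a *: x + y) - (a * g x + g y) = (g (a *: x + y) - v (a *: x + y))
        - (a * (g x - v x) + (g y - v y)).
      by rewrite vl; ring.
    apply: (@le_trans _ _ (e / (N + 1) * N)); last by rewrite ler_wpM2l ?ltW// ltrDl.
    move: d0 vP; set d := e / (N + 1) => d0 vP.
    rewrite (le_trans (ler_normB _ _))// /N [leRHS]mulrDr; apply: lerD; first exact: vP.
    rewrite (le_trans (ler_normD _ _))// [leRHS]mulrDr; apply: lerD; last exact: vP.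
    by rewrite normrM mulrCA ler_wpM2l.
  have [v1 v1P] := gP 1 ltr01; have [M M0 v1M] := gamma_dual_bound v1.
  have cg : continuous (g : tspace gamma -> K^o).
    apply: gamma_dual_continuous => // x e e0.
    have := @mixed_nbhs [set (fun x => `|g x|)] (1 + M) _ _ _ _ x e e0.
    have gZ a y : g (a *: y) = a * g y := linZ lg a y.
    have gD y z : g (y + z) = g y + g z := linD lg y z.
    have h1 p : [set (fun x => `|g x|)] p -> seminorm p.
      move=> ->; split => // [y z|a y]; first by rewrite gD ler_normD.
      by rewrite gZ normrM.
    have h2 : 0 <= 1 + M by rewrite addr_ge0.
    have h3 p y : [set (fun x => `|g x|)] p -> p y <= (1 + M) * `|y|.
      move=> ->; rewrite -(subrK (v1 y) (g y)) (le_trans (ler_normD _ _))//.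
      by rewrite mulrDl lerD.
    move=> /(_ h1 h2 h3) []; last first.
      by move=> V [oV Vx VP]; exists V; split => // y /VP /(_ _ erefl).
    move=> r d d0; have d2 : 0 < d / 2 by rewrite divr_gt0.
    have r10 : 0 < `|r| + 1 by rewrite ltr_wpDl.
    have dr : 0 < d / 2 / (`|r| + 1) by rewrite divr_gt0.
    have [v vP] := gP _ dr; have [q Gq [c c0 cP]] := gamma_dual_tau v r d2.
    exists q => //; exists c => // y yr qy _ ->.
    rewrite -(subrK (v y) (g y)) (le_trans (ler_normD _ _))// (splitr d) lerD//; last exact: cP.
    rewrite (le_trans (vP y))// -mulrA ler_piMr ?(ltW d2)// ler_pdivrMl// mulr1.
    by rewrite (le_trans yr)// -(ger0_norm (le_trans (normr_ge0 _) yr)) normr_id lerDl.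
  by exists (mk_dual (lg : linear (g : tspace gamma -> K^o)) cg).
Qed.

Local Notation PB := (banach_of gamma_dual_sup_normed).
Local Notation PT := (tspace (norm_topology (@dual_norm K X gamma))).

(** Passage between the topology on [PT] in the theorem and the norm instance on [PB]: [dual_norm]
    and [sup_norm] are the same supremum. *)
Lemma dual_norm_nbhs (f : PT) (A : set P) :
  nbhs f A <-> exists2 e : K, 0 < e & forall g : P, `|(g - f : PB)| < e -> A g.
Proof.
split=> [[B [oB Bf BA]]|[e e0 eA]].
  by have [e e0 eB] := oB f Bf; exists e => // g gf; apply: BA; exact: eB.
exists [set g : P | `|(g - f : PB)| < e]; split => //; last by rewrite /= subrr normr0.
move=> g /= gf; exists (e - `|(g - f : PB)|); first by rewrite subr_gt0.
move=> h; rewrite -[dual_norm _]/`|(h - g : PB)| ltrBrDr; apply: le_lt_trans.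
by rewrite -(subrKA (g : PB) (h : PB)) ler_normD.
Qed.

Lemma dual_norm_bound (f : P) (x : X) : `|f x| <= `|(f : PB)| * `|x|.
Proof. exact: (sup_norm_le gamma_dual_sup_normed f x). Qed.

(** Compactness enters twice: it bounds the norms on [C], and it yields a single seminorm of [G]
    making all of [C] small on a given ball, since a condition good for [f] is good near [f]. *)
Lemma dual_compact_nbhs (C : set PT) (x : X) (e : K) : compact C -> 0 < e ->
  nbhs (x : tspace gamma) [set y : X | forall f : P, C f -> `|f (y - x)| <= e].
Proof.
move=> kC e0.
have [M M0 CM] : exists2 M : K, 0 <= M & forall f : P, C f -> `|(f : PB)| <= M.
  apply: compact_locally_bounded kC _ => f Cf; exists (`|(f : PB)| + 1).
    by rewrite addr_ge0.
  apply/dual_norm_nbhs; exists 1 => // g gf /=.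
  rewrite -(subrK (f : PB) (g : PB)) (le_trans (ler_normD _ _))// addrC.
  by rewrite lerD2l ltW.
have := @mixed_nbhs [set p | exists2 f : P, C f & p = fun x => `|f x|] M _ M0 _ _ x e e0.
case.
- move=> p [f Cf ->]; split => // [y z|a y].
    by rewrite (linD (dual_linear f)) ler_normD.
  by rewrite (linZ (dual_linear f)) normrM.
- move=> p y [f Cf ->]; rewrite (le_trans (dual_norm_bound _ _))// ler_wpM2r//.
  exact: CM.
- move=> r d d0; have [[q0 Gq0] _] := dG.
  pose F := filter_from [set qc : (X -> K) * K | G qc.1 /\ 0 < qc.2]
    (fun qc => [set y : X | `|y| <= r /\ qc.1 y < qc.2]).
  have FF : Filter F.
    apply: filter_from_filter; first by exists (q0, 1) => /=.
    move=> [q1 c1] [q2 c2] /= [G1 c10] [G2 c20].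
    have [_ /(_ _ _ G1 G2)[q Gq q12]] := dG.
    have c12 := real_comparable (gtr0_real c10) (gtr0_real c20).
    exists (q, Order.min c1 c2); first by rewrite /= comparable_lt_min// c10.
    move=> y /= [yr]; rewrite comparable_lt_min// => /andP[y1 y2].
    have [qy1 qy2] := q12 y.
    by split; split => //; [exact: le_lt_trans y1|exact: le_lt_trans y2].
  have d2 : 0 < d / 2 by rewrite divr_gt0.
  have r10 : 0 < `|r| + 1 by rewrite ltr_wpDl.
  have dr : 0 < d / 2 / (`|r| + 1) by rewrite divr_gt0.
  have [|[q c] /= [Gq c0] qC] := (compact_near_coveringP C).1 kC X F
      (fun y f => `|(f : P) y| <= d) FF.
    move=> f Cf; have [q Gq [c c0 cP]] := gamma_dual_tau f r d2.
    exists ([set g : P | `|(g - f : PB)| < d / 2 / (`|r| + 1)],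
            [set y | `|y| <= r /\ q y < c]).
      split => /=; first by apply/dual_norm_nbhs; exists (d / 2 / (`|r| + 1)).
      by exists (q, c) => //; split.
    move=> [g y] /= [gf [yr yc]].
    rewrite -(subrK (f y) (g y)) (le_trans (ler_normD _ _))// (splitr d) lerD//; last exact: cP.
    rewrite -dualBE (le_trans (dual_norm_bound _ _))//.
    apply: (@le_trans _ _ (d / 2 / (`|r| + 1) * `|y|)); first by rewrite ler_wpM2r// ltW.
    rewrite -mulrA ler_piMr ?(ltW d2)// ler_pdivrMl// mulr1.
    by rewrite (le_trans yr)// -(ger0_norm (le_trans (normr_ge0 _) yr)) normr_id lerDl.
  exists q => //; exists c => // y yr yc p [f Cf ->].
  exact: (qC y).
- move=> V [oV Vx VP]; exists V; split => // y /VP /= h f Cf.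
  by apply: (h (fun x => `|f x|)); exists f.
Qed.

(** * Compactness for the mixed topology and in its dual *)

(* If [A] contains [x_n] with [q_n x_n > (n + 1)^2], then [sup_n q_n / (n + 1)] is a
   gamma-continuous seminorm, because its tail is small on norm-bounded sets, and it
   is unbounded along [x_n]. *)
Lemma gamma_compact_bounded (A : set (tspace gamma)) : compact A ->
  exists2 M : K, 0 <= M & forall x : X, A x -> `|x| <= M.
Proof.
move=> kA; apply: contrapT => nM.
have big n : exists xq : X * (X -> K), [/\ A xq.1, G xq.2 & (n.+1 ^ 2)%:R < xq.2 xq.1].
  have [x Ax xn] : exists2 x, A x & (n.+1 ^ 2)%:R < `|(x : X)|.
    apply: contrapT => nx; apply: nM; exists (n.+1 ^ 2)%:R; first exact: ler0n.
    move=> x Ax; rewrite real_leNgt ?normr_real ?realn//.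
    by apply/negP => nlt; apply: nx; exists x.
  have [q Gq qn] : exists2 q, G q & (n.+1 ^ 2)%:R < q x.
    apply: contrapT => nq; have [_ lub] := Gn x.
    suff : `|x| <= (n.+1 ^ 2)%:R by move=> /(lt_le_trans xn); rewrite ltxx.
    apply: lub => _ [q Gq <-]; have [q0 _ _] := Gs Gq.
    rewrite real_leNgt ?realn ?ger0_real//.
    by apply/negP => nlt; apply: nq; exists q.
  by exists (x, q).
have [xq xqP] := choice big.
pose p n (x : X) := (xq n).2 x / n.+1%:R.
have n0 n : 0 < n.+1%:R :> K by rewrite ltr0n.
have pn x e : 0 < e -> nbhs (x : tspace gamma) [set y : X | forall n, p n (y - x) <= e].
  move=> e0; have := @mixed_nbhs (range p) 1 _ ler01 _ _ x e e0.
  case.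
  - move=> _ [n _ <-]; have [_ /Gs[q0 qD qZ] _] := xqP n; split => [y|y z|a y].
    + by rewrite /p divr_ge0// ltW.
    + by rewrite /p -mulrDl ler_wpM2r// invr_ge0 ltW.
    + by rewrite /p qZ mulrA.
  - move=> _ y [n _ <-]; have [_ Gq _] := xqP n.
    rewrite mul1r /p ler_pdivrMr// (le_trans (saks_seminorm_le _ Gq))//.
    by rewrite ler_peMr// ler1n.
  - move=> r d d0.
    (* On the ball of radius [r], terms with [n >= N] are at most [r / (n + 1) <= d]; the finitely
       many others are dominated by one seminorm of the directed system. *)
    have [N NP] : exists N, `|r| / d < N%:R by apply: (hb_arch hK); rewrite divr_ge0// ltW.
    have [q Gq qN] : exists2 q, G q & forall n y, (n < N)%N -> (xq n).2 y <= q y.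
      elim: N {NP} => [|N [q Gq qN]]; first by have [[q Gq] _] := dG; exists q.
      have [_ GN _] := xqP N; have [_ /(_ _ _ Gq GN)[q' Gq' qq']] := dG.
      exists q' => // n y; have [q'1 q'2] := qq' y.
      rewrite ltnS leq_eqVlt => /predU1P[-> //|nN].
      exact: le_trans (qN n y nN) q'1.
    exists q => //; exists d => // y yr yd _ [n _ <-]; have [_ Gqn _] := xqP n.
    rewrite /p ler_pdivrMr//; have [nN|Nn] := ltnP n N.
      rewrite (le_trans (qN n y nN))// (le_trans (ltW yd))//.
      by rewrite ler_peMr ?(ltW d0)// ler1n.
    rewrite (le_trans (saks_seminorm_le _ Gqn))// (le_trans yr)//.
    have rr : r = `|r| by rewrite ger0_norm// (le_trans (normr_ge0 y) yr).
    rewrite {1}rr -ler_pdivrMl// mulrC (le_trans (ltW NP))// ler_nat.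
    exact: leq_trans Nn (leqnSn n).
  - move=> V [oV Vx VP]; exists V; split => // y /VP /= h n.
    by apply: h; exists n.
pose F := filter_from [set: nat] (fun n => [set (xq m).1 | m in [set m | (n <= m)%N]]).
have PF : ProperFilter F.
  apply: filter_from_proper; last by move=> n _; exists (xq n).1, n => /=.
  apply: filter_from_filter; first by exists 0%N.
  move=> n m _ _; exists (maxn n m) => // _ [k /= + <-]; rewrite geq_max => /andP[nk mk].
  by split; exists k.
have [|a [Aa clus]] := kA F PF.
  by exists 0%N => // _ [m _ <-]; have [] := xqP m.
(* For some [n >= N], clustering at [a] gives [p n (x_n - a) <= 1], hence [q_n x_n <= (n + 1) + |a|
   <= (n + 1) (|a| + 1) <= (n + 1)^2], a contradiction. *)
have [N aN] : exists N, `|(a : X)| + 1 < N%:R by apply: (hb_arch hK); rewrite addr_ge0.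
have FN : F [set (xq m).1 | m in [set m | (N <= m)%N]] by exists N.
have [_ [[n /= Nn <-] /(_ n)]] := clus _ _ FN (pn a 1 ltr01).
have [_ Gq qn] := xqP n; rewrite /p ler_pdivrMr// mul1r => qna.
have [_ qD _] := Gs Gq.
have qa : (xq n).2 (xq n).1 <= n.+1%:R + `|(a : X)|.
  rewrite -(subrK (a : X) (xq n).1) (le_trans (qD _ _))// lerD//.
  exact: saks_seminorm_le.
have : n.+1%:R + `|(a : X)| <= n.+1%:R * (`|(a : X)| + 1).
  by rewrite mulrDr mulr1 addrC lerD2r ler_peMl// ler1n.
have Na : `|(a : X)| + 1 <= n.+1%:R.
  by rewrite (le_trans (ltW aN))// ler_nat (leq_trans Nn).
move=> /(le_trans qa) /(lt_le_trans qn); rewrite expnS expn1 natrM.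
by rewrite ltr_pM2l// => /lt_le_trans /(_ Na); rewrite ltxx.
Qed.

Lemma ball_absolutely_convex :
  absolutely_convex ([set x : X | `|x| <= 1] : set (tspace gamma)).
Proof.
move=> x y a b /= x1 y1; apply: le_trans.
rewrite (le_trans (ler_normD (a *: (x : X)) (b *: (y : X))))// !normrZ.
by rewrite lerD// ler_piMr.
Qed.

(** The norm is a supremum of seminorms in [G], so the ball is [tau]-closed and therefore
    [gamma]-closed. It is [gamma]-bounded because zero neighbourhoods contain norm balls. *)
Lemma ball_gamma_compact : semi_montel (tspace gamma) ->
  compact ([set x : X | `|x| <= 1] : set (tspace gamma)).
Proof.
move=> montel.
have clB : closed ([set x : X | `|x| <= 1] : set (tspace gamma)).
  rewrite -[X in closed X]setCK; apply: open_closedC; rewrite open_tspaceE.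
  have [[_ tg _ _] _] := hgamma; apply: tg; apply/genG => x /= x1.
  have [q Gq qx] : exists2 q, G q & 1 < q x.
    apply: contrapT => nq; apply: x1; have [_] := Gn x; apply=> _ [q Gq <-].
    have [q0 _ _] := Gs Gq; rewrite real_leNgt ?real1 ?ger0_real//.
    by apply/negP => qx; apply: nq; exists q.
  exists q => //; exists (q x - 1); first by rewrite subr_gt0.
  move=> y qyx y1; have [_ qD _] := Gs Gq.
  have : q x <= q y + q (y - x).
    have := qD y (x - y); rewrite addrC subrK => /le_trans; apply.
    by rewrite -(opprB y x) seminormN//; exact: Gs.
  have qy1 : q y <= 1 by rewrite (le_trans (saks_seminorm_le _ Gq)).
  move=> /le_lt_trans /(_ (ler_ltD qy1 qyx)).
  by rewrite addrC subrK ltxx.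
have [|U BU [cU _]] := montel [set x : X | `|x| <= 1].
  move=> U /gamma_nbhs0_norm[d d0 dU]; exists (2 / d); first by rewrite divr_gt0.
  move=> s ds x /= x1; have s0 : 0 < `|s| by rewrite (lt_le_trans _ ds)// divr_gt0.
  exists (s^-1 *: x); last by rewrite scalerA divff ?scale1r// -normr_gt0.
  apply: dU; rewrite (normrZ (s^-1) (x : X)) normfV ltr_pdivrMl//.
  rewrite (le_lt_trans x1)// -ltr_pdivrMr// mul1r (lt_le_trans _ ds)//.
  by rewrite -[ltLHS]mul1r ltr_pM2r ?invr_gt0// ltr1n.
rewrite (_ : [set x : X | `|x| <= 1] = U `&` [set x : X | `|x| <= 1]).
  exact: compact_closedI.
by apply/seteqP; split => x /=; [split => //; exact: BU|case].
Qed.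

(** [C] is the polar of the zero neighbourhood [U], itself the polar of [H]. An ultrafilter on [C]
    has a pointwise limit in [C], and equicontinuity on the compact ball upgrades this to norm
    convergence. *)
Lemma equicontinuous_dual_compact (H : set P) :
  compact ([set x : X | `|x| <= 1] : set (tspace gamma)) ->
  equicontinuous_functionals H ->
  exists C : set PT, [/\ H `<=` C, absolutely_convex C & compact C].
Proof.
move=> kB eH; pose U := [set x : X | forall f : P, H f -> `|f x| <= 1].
have U0 : nbhs (0 : tspace gamma) U.
  have := eH 0 [set xy : K^o * K^o | `|xy.1 - xy.2| < 1].
  case.
    by rewrite -entourage_ballE; exists 1 => //= -[x y].
  move=> V [oV V0 VU]; exists V; split => // x /VU /= xH f Hf.
  by rewrite -normrN -sub0r -(lin0 (dual_linear f)) ltW// xH.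
have [d d0 dU] := gamma_nbhs0_norm U0.
pose C := [set f : P | forall x, U x -> `|f x| <= 1].
have CM (f : P) x : C f -> `|f x| <= 2 / d * `|x|.
  move=> Cf; apply: (@linear_bound K X K^o f d (dual_linear f) d0) => y yd.
  by apply: Cf; exact: dU.
exists C; split.
- by move=> f Hf x Ux; exact: Ux.
- move=> f g a b Cf Cg ab x Ux.
  rewrite [X in `|X|](_ : _ = a * f x + b * g x)// (le_trans (ler_normD _ _))//.
  rewrite (le_trans _ ab)// !normrM lerD// ler_piMr//; [exact: Cf|exact: Cg].
rewrite compact_ultra => F UF FC.
have PF : ProperFilter F by exact: ultra_proper.
have /choice[g gP] : forall x : X, exists l,
    forall e : K, 0 < e -> F [set f : P | `|f x - l| < e].
  move=> x; apply: (@hb_ultra K hK P F (fun f => f x) (2 / d * `|x|) UF).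
  by apply: filterS FC => f Cf; exact: CM.
have lg : linear (g : tspace gamma -> K^o).
  move=> a x y; change (g (a *: x + y) = a * g x + g y :> K).
  apply/eqP; rewrite -subr_eq0 -normr_eq0 eq_le normr_ge0 andbT.
  apply/ler_addgt0Pr => e e0; rewrite add0r.
  have N0 : 0 < 1 + (`|a| + 1) by rewrite addr_gt0// ltr_wpDl.
  have c0 : 0 < e / (1 + (`|a| + 1)) by rewrite divr_gt0.
  have [f [/= [f1 f2] f3]] :=
    filter_ex (filterI (filterI (gP (a *: x + y) _ c0) (gP x _ c0)) (gP y _ c0)).
  have fl : f (a *: x + y) = a * f x + f y :> K := dual_linear f a x y.
  rewrite -(divfK (lt0r_neq0 N0) e); move: c0 f1 f2 f3.
  set c := e / _ => c0 f1 f2 f3.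
  have -> : g (a *: x + y) - (a * g x + g y) =
      (a * (f x - g x) + (f y - g y)) - (f (a *: x + y) - g (a *: x + y)).
    by rewrite fl; ring.
  rewrite (le_trans (ler_normB _ _))// [leRHS]mulrDr mulr1 [leRHS]addrC.
  apply: lerD; last exact: ltW.
  rewrite (le_trans (ler_normD _ _))// [leRHS]mulrDr mulr1 lerD ?(ltW f3)//.
  by rewrite normrM mulrC ler_wpM2r// ltW.
have gU x : U x -> `|g x| <= 1.
  move=> Ux; apply/ler_addgt0Pr => e e0.
  have [f [/= Cf fx]] := filter_ex (filterI FC (gP x _ e0)).
  rewrite -(subrK (f x) (g x)) (le_trans (ler_normD _ _))// addrC lerD//; first exact: Cf.
  by rewrite distrC ltW.
have gZ e y : 0 < e -> U (e^-1 *: y) -> `|g y| <= e.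
  move=> e0 /gU; rewrite (linZ lg) normrM normfV (gtr0_norm e0).
  by rewrite ler_pdivrMl// mulr1.
have cg : continuous (g : tspace gamma -> K^o).
  apply: gamma_dual_continuous => // x e e0.
  by apply: nbhs_tspaceS (gamma_nbhs_scale x e^-1 U0) => y /=; exact: gZ.
pose gd : P := mk_dual lg cg.
have Cg : C gd by exact: gU.
exists gd; split => // A /dual_norm_nbhs[e e0 eA].
(* One third for each term of f y - g y = f (y - x) + (f x - g x) - g (y - x). *)
have e3 : 0 < e / 2 / 3 by rewrite !divr_gt0.
have : F [set f : P | forall x : X, `|x| <= 1 -> `|f x - g x| <= e / 2].
  apply: ((compact_near_coveringP _).1 kB P F
    (fun (f : P) (x : X) => `|f x - g x| <= e / 2) _) => x _.
  exists ([set y : X | U ((e / 2 / 3)^-1 *: (y - x))],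
          [set f : P | C f /\ `|f x - g x| < e / 2 / 3]).
    by split => /=; [exact: gamma_nbhs_scale|exact: filterI FC (gP x _ e3)].
  move=> [y f] /= [Uyx [Cf fx]].
  have fyx : `|f (y - x)| <= e / 2 / 3.
    have := Cf _ Uyx; rewrite (linZ (dual_linear f)) normrM normfV (gtr0_norm e3).
    by rewrite ler_pdivrMl// mulr1.
  have gyx := gZ _ _ e3 Uyx.
  have -> : f y - g y = f (y - x) + (f x - g x) - g (y - x).
    by rewrite (linB (dual_linear f)) (linB lg); ring.
  have -> : e / 2 = e / 2 / 3 + e / 2 / 3 + e / 2 / 3 by field.
  rewrite (le_trans (ler_normB _ _))// lerD// (le_trans (ler_normD _ _))// lerD//.
  exact: ltW.
apply: filterS => f fg; apply: eA.
have [_ _ le_norm] := sup_normP gamma_dual_sup_normed (f - gd).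
apply: (@le_lt_trans _ _ (e / 2)).
  by apply: le_norm => [|x x1]; [rewrite divr_ge0// ltW|rewrite dualBE fg].
by rewrite ltr_pdivrMr// mulr_natr mulr2n ltrDl.
Qed.

(** * Operators and equicontinuity in terms of the dual norm *)

Context (kB : compact ([set x : X | `|x| <= 1] : set (tspace gamma))).

(** Since [gamma]-compact sets are norm bounded, norm convergence of functionals implies convergence
    in [dual_kappa]. *)
Lemma eps_gamma_bound (E : normedModType K) (u : eps_map (tspace gamma) E) :
  exists2 M : K, 0 <= M & forall f : P, `|u f| <= M * `|(f : PB)|.
Proof.
have : nbhs (0 : PB) --> (0 : dual_kappa (tspace gamma)).
  apply: kappa_cvg => A e _ kA e0.
  have [M M0 AM] := gamma_compact_bounded kA.
  have M10 : 0 < M + 1 by rewrite ltr_wpDl.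
  apply/(@nbhs0_norm_ltP K PB); exists (e / (M + 1)); first by rewrite /= divr_gt0.
  move=> f /= fe x Ax; rewrite sub0r normrN.
  rewrite (le_lt_trans (dual_norm_bound f x))//.
  rewrite ltr_pdivlMr// in fe; apply: le_lt_trans fe.
  by rewrite ler_wpM2l// (le_trans (AM x Ax))// lerDl.
have /kappa_continuousP/(_ 0 _ ltr01) u1 := @eps_continuous _ _ _ u.
move=> /(_ _ u1); rewrite (lin0 (eps_linear u)).
move=> /(@nbhs0_norm_ltP K PB)[d /= d0 du]; exists (2 / d); first by rewrite divr_ge0// ltW.
apply: (@linear_bound K PB E u d) => //; first exact: eps_linear.
by move=> f /du /=; rewrite sub0r normrN.
Qed.

(** The unit ball is itself one of the absolutely convex compact sets defining [dual_kappa]. *)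
Lemma eps_gamma_continuous (E : normedModType K) (u : P -> E) (M : K) :
  linear u -> 0 <= M -> (forall f : P, `|u f| <= M * `|(f : PB)|) ->
  continuous (u : dual_kappa (tspace gamma) -> E).
Proof.
move=> lu M0 uM; apply/kappa_continuousP => f e e0.
have M10 : 0 < M + 1 by rewrite ltr_wpDl.
have d0 : 0 < e / (M + 1) by rewrite divr_gt0.
apply: filterS (kappa_nbhs f ball_absolutely_convex kB d0) => g fg.
rewrite /= -(linB lu) (le_trans (uM _))//.
apply: (@le_trans _ _ ((M + 1) * `|(f - g : PB)|)).
  by rewrite ler_wpM2r// lerDl.
rewrite -ler_pdivlMl// mulrC.
have [_ _] := sup_normP gamma_dual_sup_normed (f - g); apply; first exact: ltW.
by move=> x x1; rewrite ltW//; exact: fg.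
Qed.

(** Lets equicontinuity over [PT] be handled as a uniform norm bound; [dual_norm_equicontinuous] is
    the converse. *)
Lemma dual_norm_dual_bound (H : set (dual PT)) : equicontinuous_functionals H ->
  exists2 M : K, 0 <= M &
    forall (z : dual PT), H z -> forall f : P, `|z f| <= M * `|(f : PB)|.
Proof.
move=> eH.
have := eH 0 [set xy : K^o * K^o | `|xy.1 - xy.2| < 1].
have e1 : entourage [set xy : K^o * K^o | `|xy.1 - xy.2| < 1].
  by rewrite -entourage_ballE; exists 1 => //= -[x y].
move=> /(_ e1) /(dual_norm_nbhs)[d d0 dH].
exists (2 / d); first by rewrite divr_ge0// ltW.
move=> z Hz; apply: (@linear_bound K PB K^o z d) => //; first exact: dual_linear z.
move=> f fd; have := dH f; rewrite subr0 => /(_ fd z Hz) /=.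
by rewrite (lin0 (dual_linear z)) sub0r normrN => /ltW.
Qed.

Lemma dual_norm_equicontinuous (H : set (dual PT)) (M : K) : 0 <= M ->
  (forall (z : dual PT), H z -> forall f : P, `|z f| <= M * `|(f : PB)|) ->
  equicontinuous_functionals H.
Proof.
move=> M0 HM f V; rewrite -entourage_ballE => -[e /= e0 eV].
have M10 : 0 < M + 1 by rewrite ltr_wpDl.
apply/(dual_norm_nbhs); exists (e / (M + 1)); first by rewrite divr_gt0.
move=> g gf z Hz; apply: eV => /=; rewrite -ball_normE /= -(linB (dual_linear z)).
rewrite (le_lt_trans (HM z Hz _))//.
apply: (@le_lt_trans _ _ ((M + 1) * `|(f - g : PB)|)).
  by rewrite ler_wpM2r// lerDl.
by rewrite -ltr_pdivlMl// mulrC -[`|_|]normrN opprB.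
Qed.

Lemma dual_norm_dual_continuous (z : P -> K^o) (M : K) : linear z -> 0 <= M ->
  (forall f : P, `|z f| <= M * `|(f : PB)|) -> continuous (z : PT -> K^o).
Proof.
move=> lz M0 zM f.
suff : forall e : K, 0 < e -> \forall g \near (f : PT), `|z f - z g| <= e.
  by move=> /(@cvgrPdist_le K K^o _ _ (@nbhs_filter PT f)).
move=> e e0; have M10 : 0 < M + 1 by rewrite ltr_wpDl.
apply/(dual_norm_nbhs); exists (e / (M + 1)); first by rewrite divr_gt0.
move=> g gf; rewrite -(linB lz) (le_trans (zM _))//.
apply: (@le_trans _ _ ((M + 1) * `|(f - g : PB)|)).
  by rewrite ler_wpM2r// lerDl.
by rewrite -ler_pdivlMl// mulrC -[`|_|]normrN opprB ltW.
Qed.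

Lemma dual_compact_equicontinuous (C : set PT) : compact C ->
  equicontinuous_functionals (C : set P).
Proof.
move=> kC x V; rewrite -entourage_ballE => -[e /= e0 eV].
have e2 : 0 < e / 2 by rewrite divr_gt0.
apply: nbhs_tspaceS (dual_compact_nbhs x kC e2) => y /= yC f Cf.
apply: eV; rewrite /= -ball_normE /= distrC -(linB (dual_linear f)).
by rewrite (le_lt_trans (yC f Cf))// ltr_pdivrMr// mulr_natr mulr2n ltrDl.
Qed.

(** * The two implications *)

Lemma approximation_property_dual :
  approximation_property (tspace gamma) -> approximation_property PT.
Proof.
move=> /approximation_propertyP apX; apply/approximation_propertyP => E u H e eH e0.
have [C kC [M M0 uM]] := eps_compact_bound u.
have [N N0 HN] := dual_norm_dual_bound eH.
have M10 : 0 < M + 1 by rewrite ltr_wpDl.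
have N10 : 0 < N + 1 by rewrite ltr_wpDl.
pose s := e / (M + 1).
have s0 : 0 < s by rewrite divr_gt0.
have d0 : 0 < s / (N + 1) by rewrite divr_gt0.
(* The identity of the dual, seen as an element of the eps product with the Banach space [PB], is
   what gets approximated on [C]. *)
have lid : linear (fun f : P => f : PB) by [].
have cid : continuous ((fun f : P => f : PB) : dual_kappa (tspace gamma) -> PB).
  by apply: (@eps_gamma_continuous PB _ 1) => // f; rewrite mul1r.
have [T [n [b Tb]] CT] := apX PB (mk_eps lid cid) C _ (dual_compact_equicontinuous kC) d0.
have [L L0 TL] := eps_gamma_bound T.
have [m [p [c [B [Tc cl [B0 cB]]]]]] := finite_rank_coord hK (eps_linear T) Tb.
have cc i : continuous (c i : PT -> K^o).
  apply: (@dual_norm_dual_continuous _ (B * L)).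
  - by move=> a f g; exact: cl.
  - exact: mulr_ge0.
  - by move=> f; rewrite (le_trans (cB i f))// -mulrA ler_wpM2l.
have lc i : linear (c i : PT -> K^o) by move=> a f g; exact: cl.
pose cd i : dual PT := mk_dual (lc i) (cc i).
have lzT (z : dual PT) : linear ((fun f : P => z (T f)) : PT -> K^o).
  by move=> a f g /=; rewrite (eps_linear T a f g) (dual_linear z).
have czT (z : dual PT) : continuous ((fun f : P => z (T f)) : PT -> K^o).
  have [Mz Mz0 zM] := dual_norm_dual_bound (equicontinuous_set1 z).
  apply: (@dual_norm_dual_continuous _ (Mz * L)).
  - exact: lzT.
  - exact: mulr_ge0.
  - by move=> f; rewrite (le_trans (zM z erefl _))// -mulrA ler_wpM2l.
pose zT z := mk_dual (lzT z) (czT z).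
have lw : linear (fun z => u (zT z)).
  move=> a z t; rewrite -(eps_linear u); congr (u _); exact: dualP.
have cT : continuous ((fun f : P => T f : P) : PT -> PT).
  move=> f A /dual_norm_nbhs[r r0 rA]; apply/dual_norm_nbhs.
  have L10 : 0 < L + 1 by rewrite ltr_wpDl.
  exists (r / (L + 1)); first by rewrite divr_gt0.
  move=> g gf; apply: rA; rewrite -(linB (eps_linear T)) (le_lt_trans (TL _))//.
  apply: (@le_lt_trans _ _ ((L + 1) * `|(g - f : PB)|)).
    by rewrite ler_wpM2r// lerDl.
  by rewrite -ltr_pdivlMl// mulrC.
have cw : continuous ((fun z => u (zT z)) : dual_kappa PT -> E).
  apply/kappa_continuousP => z r r0.
  have /kappa_continuousP/(_ (zT z) _ r0) := @eps_continuous _ _ _ u.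
  suff : zT @ nbhs (z : dual_kappa PT) --> (zT z : dual_kappa PT) by apply.
  apply: kappa_cvg => A d cA kA d0'.
  (* Precomposition with [T] is continuous on [dual_kappa PT] because [T] maps absolutely convex
     compact sets to such sets. *)
  have kTA : compact [set (T f : PT) | f in A].
    by apply: continuous_compact kA; exact: continuous_subspaceT.
  have cTA : absolutely_convex ([set (T f : PT) | f in A] : set PT).
    move=> _ _ x y [f Af <-] [g Ag <-] xy; exists (x *: f + y *: g); first exact: cA.
    by rewrite (linD (eps_linear T)) !(linZ (eps_linear T)).
  have := kappa_nbhs z cTA kTA d0'; apply: filterS => t zt f Af.
  by apply: (zt (T f)); exists f.
exists (mk_eps lw cw).
  (* From [T f], the sum of [c i f *: p i], it follows that [zT z] is the sum of
     [z (p i) *: cd i]. *)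
  exists m, (fun i => u (cd i)) => z; exists (fun i => z (p i)).
  have -> : (mk_eps lw cw) z = u (\sum_(i < m) z (p i) *: cd i).
    congr (u _); apply: dualP => f /=; rewrite Tc.
    rewrite (lin_sum (dual_linear z)).
    rewrite -[RHS]/((\sum_(i < m) z (p i) *: cd i : dual PT) f).
    have -> : (\sum_(i < m) z (p i) *: cd i : dual PT) f = \sum_(i < m) z (p i) * c i f.
      by elim/big_rec2: _ => // i y g _ <-.
    by apply: eq_bigr => i _; rewrite (linZ (dual_linear z)) mulrC.
  rewrite (lin_sum (eps_linear u)); apply: eq_bigr => i _.
  by rewrite (linZ (eps_linear u)).
move=> z Hz /=; rewrite -(linB (eps_linear u)).
apply: (@le_lt_trans _ _ (M * s)).
  apply: uM => // f Cf.
  have -> : (z - zT z) f = z ((f : PB) - T f) by rewrite (linB (dual_linear z)).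
  rewrite (le_trans (HN z Hz _))//.
  apply: (@le_trans _ _ ((N + 1) * `|(f : PB) - T f|)).
    by rewrite ler_wpM2r// lerDl.
  by rewrite -ler_pdivlMl// mulrC ltW// CT.
by rewrite /s mulrA ltr_pdivrMr// mulrDr mulr1 [ltLHS]mulrC ltrDl.
Qed.

Lemma approximation_property_predual :
  approximation_property PT -> approximation_property (tspace gamma).
Proof.
move=> /approximation_propertyP apP; apply/approximation_propertyP => E v H e eH e0.
have [C [HC cC kC]] := equicontinuous_dual_compact kB eH.
have [N N0 vN] := eps_gamma_bound v.
have N10 : 0 < N + 1 by rewrite ltr_wpDl.
(* Two errors of size [d] will add up: from replacing [u] by [w], and each [p i] by a functional
   [z i]. *)
pose d := e / (N + 1) / 2 / 2.
have d0 : 0 < d by rewrite !divr_gt0.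
pose F : completeNormedModType K := banach_of (dual_closure_sup_normed hK kC).
have hF := dual_closure_sup_normed hK kC.
have restr_le (f : dual_closure C) (s : K) : 0 <= s ->
    (forall y : P, C y -> `|f y| <= s) -> `|(f : F)| <= s.
  by move=> s0 fs; have [_ _] := sup_normP hF f; apply.
have le_restr (f : dual_closure C) (y : P) : C y -> `|f y| <= `|(f : F)|.
  by move=> Cy; have [_ + _] := sup_normP hF f; apply.
pose u (z : dual PT) : F := dual_closure_restr C z.
have lu : linear u := dual_closure_restr_linear C.
have cu : continuous (u : dual_kappa PT -> F).
  apply/kappa_continuousP => z r r0.
  apply: filterS (kappa_nbhs z cC kC r0) => t zt /=.
  rewrite -(linB lu); apply: restr_le => [|y Cy]; first exact: ltW.
  by rewrite dual_closure_restrE// dualBE ltW// zt.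
have levx (x : X) : linear ((fun f : P => f x) : PT -> K^o) by [].
have cevx (x : X) : continuous ((fun f : P => f x) : PT -> K^o).
  apply: (@dual_norm_dual_continuous _ `|x|) => // f.
  by rewrite mulrC dual_norm_bound.
pose ev (x : X) : dual PT := mk_dual (levx x) (cevx x).
have lev a x y : ev (a *: x + y) = a *: ev x + ev y.
  by apply: dualP => f; exact: (dual_linear f).
have eqev : equicontinuous_functionals [set ev x | x in [set x : X | `|x| <= 1]].
  apply: (@dual_norm_equicontinuous _ 1) => //.
  move=> _ [x /= x1 <-] f; rewrite mul1r (le_trans (dual_norm_bound f x))//.
  by rewrite ler_piMr.
have [w [n [b wb]] uw] := apP F (mk_eps lu cu) _ d eqev d0.
have [m [p [c [B [wc cl [B0 cB]]]]]] := finite_rank_coord hK (eps_linear w) wb.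
have [C' kC' [L L0 wL]] := eps_compact_bound w.
have lg i : linear ((fun x => c i (ev x)) : tspace gamma -> K^o).
  by move=> a x y; rewrite lev cl.
have cg i : continuous ((fun x => c i (ev x)) : tspace gamma -> K^o).
  apply: gamma_dual_continuous (lg i) _ => x r r0.
  have BL : 0 < B * L + 1 by rewrite ltr_wpDl// mulr_ge0.
  have s0 : 0 < r / (B * L + 1) by rewrite divr_gt0.
  apply: nbhs_tspaceS (dual_compact_nbhs x kC' s0) => y /= yC.
  (* The coordinate is bounded by [B * L] times the supremum over the compact set [C'], and
     smallness on [C'] holds on a [gamma]-neighbourhood. *)
  rewrite (le_trans (cB i _))//.
  have := wL (ev (y - x)) _ s0 yC => /(ler_wpM2l B0) /le_trans; apply.
  rewrite (_ : B * (L * _) = r * (B * L / (B * L + 1))); last by ring.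
  rewrite ler_piMr ?(ltW r0)// ler_pdivrMr// mul1r.
  by rewrite lerDl.
pose g i : P := mk_dual (lg i) (cg i).
(* On the unit ball the values [|g i x|] sum to at most [S], so errors [d / (S + 1)] in the [p i]
   cost at most [d]. *)
pose S := \sum_(i < m) `|(g i : PB)|.
have S10 : 0 < S + 1 by rewrite ltr_wpDl// sumr_ge0.
have dS : 0 < d / (S + 1) by rewrite divr_gt0.
have /choice[z zP] : forall i, exists z : dual PT,
    forall y : P, C y -> `|p i y - z y| <= d / (S + 1).
  by move=> i; have [_] := dual_closureP (p i); apply.
(* For [f] in [C] and [x] in the unit ball, [f x] is the value of [u (ev x)] at [f], close to the
   sum of [g i x * p i f]; here [p i] is replaced by [z i]. *)
pose T (f : P) : P := \sum_(i < m) z i f *: g i.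
have lT : linear T.
  move=> a f h; rewrite /T scaler_sumr -big_split/=; apply: eq_bigr => i _.
  by rewrite (dual_linear (z i)) scalerDl scalerA.
have TE f x : T f x = \sum_(i < m) z i f * g i x :> K.
  by rewrite /T; elim/big_rec2: _ => // i y h _ <-.
have fT (f : P) : C f -> `|(f - T f : PB)| <= d + d.
  move=> Cf; have [_ _] := sup_normP gamma_dual_sup_normed (f - T f); apply.
    by rewrite addr_ge0// ltW.
  move=> x /= x1; change (`|f x - T f x| <= d + d); rewrite TE.
  have wE : w (ev x) f = \sum_(i < m) c i (ev x) * p i f :> K.
    by rewrite wc; elim/big_rec2: _ => // i y h _ <-.
  have -> : f x - \sum_(i < m) z i f * g i x =
      (f x - w (ev x) f) + \sum_(i < m) c i (ev x) * (p i f - z i f).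
    rewrite wE; under [X in _ = _ + X]eq_bigr do rewrite mulrBr.
    rewrite sumrB addrA subrK; congr (_ - _).
    by apply: eq_bigr => i _; rewrite mulrC.
  rewrite (le_trans (ler_normD _ _))// lerD//.
    have : `|u (ev x) - w (ev x)| < d by apply: uw; exists x.
    move=> /ltW; apply: le_trans.
    have := le_restr (u (ev x) - w (ev x)) f Cf.
    by rewrite -[X in `|X| <= _ -> _]/(u (ev x) f - w (ev x) f) dual_closure_restrE.
  apply: (@le_trans _ _ (S * (d / (S + 1)))); last first.
    by rewrite mulrCA ler_piMr ?(ltW d0)// ler_pdivrMr// mul1r lerDl.
  rewrite (le_trans (ler_norm_sum _ _ _))// mulr_suml ler_sum// => i _.
  rewrite normrM; apply: ler_pM => //; last exact: zP.
  rewrite -[c i (ev x)]/(g i x) (le_trans (dual_norm_bound _ _))//.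
  by rewrite ler_piMr.
have [L' L'0 TL] : exists2 L', 0 <= L' & forall f : P, `|(T f : PB)| <= L' * `|(f : PB)|.
  have /choice[Mz zM] : forall i, exists Mi : K,
      0 <= Mi /\ forall f : P, `|z i f| <= Mi * `|(f : PB)|.
    move=> i; have [Mi Mi0 zMi] :=
      dual_norm_dual_bound (equicontinuous_set1 (z i)).
    by exists Mi; split => // f; exact: zMi.
  exists (\sum_(i < m) Mz i * `|(g i : PB)|).
    by apply: sumr_ge0 => i _; rewrite mulr_ge0//; case: (zM i).
  move=> f; rewrite -[T f]/(\sum_(i < m) z i f *: (g i : PB)) (le_trans (ler_norm_sum _ _ _))//.
  rewrite mulr_suml ler_sum// => i _.
  by rewrite (normrZ (z i f)) mulrAC ler_wpM2r//; case: (zM i).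
have lvT : linear (fun f => v (T f)) by move=> a f h; rewrite lT (eps_linear v).
have cvT : continuous ((fun f => v (T f)) : dual_kappa (tspace gamma) -> E).
  apply: (@eps_gamma_continuous E _ (N * L')) => // [|f]; first exact: mulr_ge0.
  by rewrite (le_trans (vN _))// -mulrA ler_wpM2l.
exists (mk_eps lvT cvT).
  exists m, (fun i => v (g i)) => f; exists (fun i => z i f).
  rewrite -[LHS]/(v (T f)) (lin_sum (eps_linear v)); apply: eq_bigr => i _.
  by rewrite (linZ (eps_linear v)).
move=> f /HC Cf; rewrite -[(mk_eps _ _) f]/(v (T f)) -(linB (eps_linear v)).
rewrite (le_lt_trans (vN _))//.
apply: (@le_lt_trans _ _ (N * (d + d))); first by rewrite ler_wpM2l// fT.
rewrite /d -splitr; apply: (@le_lt_trans _ _ (N * (e / (N + 1)))).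
  by rewrite ler_wpM2l// ler_pdivrMr// mulr_natr mulr2n lerDl divr_ge0// ltW.
by rewrite mulrA ltr_pdivrMr// mulrDr mulr1 [ltLHS]mulrC ltrDl.
Qed.

End Saks.

Theorem proposition2p6 (R : realType) (K : numFieldType)
    (hK : K = R :> numFieldType \/ K = R[i] :> numFieldType)
    (X : normedModType K) (tau gamma : topology X)
    (hsaks : saks_space tau) (hgamma : is_mixed_topology tau gamma)
    (hmontel : semi_montel (tspace gamma)) :
  approximation_property (tspace gamma) <->
  approximation_property (tspace (norm_topology (@dual_norm K X gamma))).
Proof.
have hb : heine_borel_field K.
  by case: hK => ->; [exact: real_heine_borel|exact: complex_heine_borel].
have [_ _ _ _ [G [dG Gs genG Gn]]] := hsaks.
have Gsn q : G q -> seminorm q by move=> /Gs[].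
have kB := ball_gamma_compact Gsn genG Gn hgamma hmontel.
split; first exact: (approximation_property_dual hb dG Gsn genG Gn hgamma kB).
exact: (approximation_property_predual hb dG Gsn genG Gn hgamma kB).
Qed.
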